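(* Let $X$, $d$, $r$, $\mathcal{L}$ and the refined data $\mathfrak{h}=(\mathcal{L},V_{X_1},V_{X_2},V_{X_3})$ be as described in the context, with spaces $K_{il}$. A collection of subspaces $V_{il}=V_{(i,d-i-l,l)}\subseteq H^0(X,\mathcal{L}_{il})$, indexed by the integers $i,l\ge 0$ with $i+l\le d$, is an exact extension of $\mathfrak{h}$ if and only if it is obtained by the following construction: (a) $V_{0l}=K_{0l}$ for $0\le l\le d$, and $V_{d0}=V_{X_1}$. (b) For $0<i<d$ (in the order $i=1,\dots,d-1$) and $0\le l\le d-i$ (in the order $l=d-i,\dots,0$), put $\underline{d}=(i,d-i-l,l)$, $\underline{d}'=(i-1,d-i-l+2,l-1)$ (if $l>0$), $\underline{d}''=(i-1,d-i-l+1,l)$, $\underline{d}'''=(i,d-i-l-1,l+1)$ (if $i+l<d$), and $\beta=\dim V_{\underline{d}''}^{X_1,0}-\dim(V_{\underline{d}''}^{X_2^c,0}\oplus V_{\underline{d}''}^{X_3^c,0})$. Then there are linearly independent $u_1,\dots,u_\beta\in V_{\underline{d}''}^{X_1,0}$ with $V_{\underline{d}''}^{X_1,0}=(V_{\underline{d}''}^{X_2^c,0}\oplus V_{\underline{d}''}^{X_3^c,0})\oplus\langle u_1,\dots,u_\beta\rangle$ and elements $v_1,\dots,v_\beta\in K_{il}$ with $\varphi_{\underline{d},\underline{d}''}(v_m)=u_m$ for all $m$, such that $$V_{il}=\varphi_{\underline{d}',\underline{d}}(V_{\underline{d}'})+\varphi_{\underline{d}''',\underline{d}}(V_{\underline{d}'''})+\langle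 v_1,\dots,v_\beta\rangle,$$ where the first summand is omitted if $l=0$ and the second summand is omitted if $i+l=d$.
   Context: Curves are projective over an algebraically closed field $k$. $X$ is the union of three smooth connected curves $X_1,X_2,X_3$, where $X_1,X_2$ meet transversally at a single point $A$, $X_2,X_3$ meet transversally at a single point $B\neq A$, and $X_1\cap X_3=\emptyset$. For a union $Y$ of some components of $X$, $Y^c$ is the union of the other components. Fix integers $d,r\ge 0$ and an invertible sheaf $\mathcal{L}$ on $X$ of degree $d$ on $X_1$ and degree $0$ on $X_2$ and $X_3$. For integers $i,l\ge 0$ with $i+l\le d$, and $\underline{d}=(i,d-i-l,l)$, let $\mathcal{L}_{\underline{d}}=\mathcal{L}_{il}$ be the invertible sheaf on $X$ with restrictions $\mathcal{L}|_{X_1}(-(d-i)A)$, $\mathcal{L}|_{X_2}((d-i)A-lB)$, $\mathcal{L}|_{X_3}(lB)$; it has multidegree $\underline{d}$. Put $\mathcal{L}_{X_1}=\mathcal{L}_{(d,0,0)}$, $\mathcal{L}_{X_2}=\mathcal{L}_{(0,d,0)}$, $\mathcal{L}_{X_3}=\mathcal{L}_{(0,0,d)}$. Maps. For $\underline{d}=(i,d-i-l,l)\ge\underline 0$ and $q\in\{1,2,3\}$ let $\widetilde{\underline{d}}$ be $(i-1,d-i-l+1,l)$ if $q=1$, $(i+1,d-i-l-2,l+1)$ if $q=2$, $(i,d-i-l+1,l-1)$ if $q=3$. Whenever $\widetilde{\underline{d}}\ge\underline 0$ there are natural maps $\varphi_{\underline{d},\widetilde{\underline{d}}}:\mathcal{L}_{\underline{d}}\to\mathcal{L}_{\underline{d}}|_{X_q^c}=\mathcal{L}_{\widetilde{\underline{d}}}|_{X_q^c}(-X_q\cap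 X_q^c)\hookrightarrow\mathcal{L}_{\widetilde{\underline{d}}}$ and $\varphi_{\widetilde{\underline{d}},\underline{d}}:\mathcal{L}_{\widetilde{\underline{d}}}\to\mathcal{L}_{\widetilde{\underline{d}}}|_{X_q}=\mathcal{L}_{\underline{d}}|_{X_q}(-X_q\cap X_q^c)\hookrightarrow\mathcal{L}_{\underline{d}}$ (restriction followed by inclusion, i.e. extension by zero); the same symbols denote the induced maps on global sections. For a subspace $V\subseteq H^0(X,\mathcal{L}_{\underline{d}})$ and a subcurve $Y$, $V^{Y,0}$ is the subspace of sections in $V$ vanishing on $Y$. Refined data $\mathfrak{h}$. $V_{X_q}\subseteq H^0(X,\mathcal{L}_{X_q})$ ($q=1,2,3$) are subspaces of dimension $r+1$ which are linked: the compositions of the maps $\varphi$ along the chains of multidegrees $(d,0,0),(d-1,1,0),\dots,(0,d,0)$ and $(0,d,0),(0,d-1,1),\dots,(0,0,d)$, in both directions, map $V_{X_1}$ into $V_{X_2}$, $V_{X_2}$ into $V_{X_1}$, $V_{X_2}$ into $V_{X_3}$ and $V_{X_3}$ into $V_{X_2}$. Restriction to $X_q$ is injective on $V_{X_q}$, and $V_{X_q}$ is also regarded as a linear series in $H^0(X_q,\mathcal{L}_{X_q}|_{X_q})$; for an effective divisor $D$ supported at the nodes on $X_q$, $V_{X_q}(-D)$ is the subspace of sections of this linear series vanishing along $D$. Let $a_0<\dots<a_r$ be the orders of vanishing of $V_{X_1}$ at $A$, $b_0<\dots<b_r$ and $b'_0<\dots<b'_r$ those of $V_{X_2}$ at $A$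 and at $B$, and $c_0<\dots<c_r$ those of $V_{X_3}$ at $B$. The associated Eisenbud–Harris limit linear series is assumed refined: $a_{r-j}+b_j=d$ and $b'_j+c_{r-j}=d$ for $0\le j\le r$. Kernels. Since $\mathcal{L}_{il}|_{X_1}=\mathcal{L}_{X_1}|_{X_1}(-(d-i)A)$, $\mathcal{L}_{il}|_{X_2}=\mathcal{L}_{X_2}|_{X_2}(-iA-lB)$, $\mathcal{L}_{il}|_{X_3}=\mathcal{L}_{X_3}|_{X_3}(-(d-l)B)$, one defines $K_{il}\subseteq H^0(X,\mathcal{L}_{il})$ (for $i,l\ge0$, $i+l\le d$) as the space of sections $s$ with $s|_{X_1}\in V_{X_1}(-(d-i)A)$, $s|_{X_2}\in V_{X_2}(-iA-lB)$ and $s|_{X_3}\in V_{X_3}(-(d-l)B)$. Equivalently, $K_{il}$ is the kernel of the evaluation (gluing) map $V_{X_1}(-(d-i)A)\oplus V_{X_2}(-iA-lB)\oplus V_{X_3}(-(d-l)B)\to k\oplus k$ at $A$ and $B$. Limit linear series and extensions. A limit linear series on $X$ of degree $d$ and dimension $r$ with sheaf $\mathcal{L}$ is a collection of subspaces $V_{\underline{d}}\subseteq H^0(X,\mathcal{L}_{\underline{d}})$ of dimension $r+1$, one for each $\underline{d}=(i,d-i-l,l)\ge\underline 0$, such that $\varphi_{\underline{d},\widetilde{\underline{d}}}(V_{\underline{d}})\subseteq V_{\widetilde{\underline{d}}}$ and $\varphi_{\widetilde{\underline{d}},\underline{d}}(V_{\widetilde{\underline{d}}})\subseteq V_{\underline{d}}$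 for all $\underline{d}$ and $q$ with $\widetilde{\underline{d}}\ge\underline 0$. It is exact if always $\varphi_{\underline{d},\widetilde{\underline{d}}}(V_{\underline{d}})=V_{\widetilde{\underline{d}}}^{X_q,0}$ and $\varphi_{\widetilde{\underline{d}},\underline{d}}(V_{\widetilde{\underline{d}}})=V_{\underline{d}}^{X_q^c,0}$. An extension of $\mathfrak{h}$ is a limit linear series with sheaf $\mathcal{L}$ such that $V_{(d,0,0)}=V_{X_1}$, $V_{(0,d,0)}=V_{X_2}$, $V_{(0,0,d)}=V_{X_3}$; an exact extension is an extension which is exact. *)

(* Defs.v *)
From HB Require Import structures.
From mathcomp Require Import all_boot all_order all_algebra.
From mathcomp Require Import boolp classical_sets functions.
From mathcomp Require Import freeg.

Set Implicit Arguments.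
Unset Strict Implicit.
Unset Printing Implicit Defensive.

Import Order.TTheory GRing.Theory Num.Theory.

Local Open Scope classical_set_scope.
Local Open Scope ring_scope.

(* A smooth connected projective curve over the algebraically closed field k  *)
(* is given by its function field F: its closed points are the normalized     *)
(* discrete valuations of F trivial on k, an invertible sheaf on it is O(D)   *)
(* for a divisor D, and H^0(O(D)) = {f | f = 0 or ord_P f >= - D(P) for all   *)
(* P}.  An invertible sheaf on a nodal union of such curves is an invertible  *)
(* sheaf on each component together with an identification of the two fibres  *)
(* over each node; its sections are the tuples of sections on the components  *)
(* that agree at the nodes.                                                   *)

(* Subspaces are sets of vectors, since the ambient spaces (products of       *)
(* function fields) are infinite-dimensional.                                 *)
Section LinearAlgebra.
Variables (k : fieldType) (M : lmodType k).
Implicit Types (U W : set M) (n : nat).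

Definition subspace U : Prop := submod_closed [in U].

Definition lin_indep n (e : 'I_n -> M) : Prop :=
  forall c : 'I_n -> k, \sum_i c i *: e i = 0 -> forall i, c i = 0.

Definition lin_span n (e : 'I_n -> M) : set M :=
  range (fun c : 'I_n -> k => \sum_i c i *: e i).

Definition has_dim U n : Prop :=
  exists2 e : 'I_n -> M, lin_indep e & U = lin_span e.

Definition add_space U W : set M := [set u + w | u in U & w in W].

Definition is_direct_sum V U W : Prop :=
  V = add_space U W /\ U `&` W = [set 0].

End LinearAlgebra.

HB.structure Definition FieldAlgebra (k : nzRingType) :=
  {F of GRing.Field F & GRing.ComUnitAlgebra k F}.
Notation fieldAlgType k := (FieldAlgebra.type k).

(* F is a finite extension of k(x) for some x transcendental over k; the last *)
(* clause says that F is spanned over k(x) by e_1, ..., e_n.                  *)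
Definition is_function_field (k : fieldType) (F : fieldAlgType k) : Prop :=
  exists x : F,
    (forall p : {poly k}, p != 0 -> horner_alg x p != 0) /\
    exists (n : nat) (e : 'I_n -> F), forall y : F,
      exists (q : {poly k}) (p : 'I_n -> {poly k}),
        q != 0 /\ horner_alg x q * y = \sum_i horner_alg x (p i) * e i.

Record curve (k : closedFieldType) := Curve {
  ratfun :> fieldAlgType k;
  curveP : is_function_field ratfun
}.

(* [ord f] is meaningful for f != 0; its value at 0 is fixed so that a point  *)
(* is determined by its valuation.                                            *)
Record point (k : closedFieldType) (C : curve k) := Point {
  ord : C -> int;
  ord0 : ord 0 = 0;
  ordM : forall f g : C, f != 0 -> g != 0 -> ord (f * g) = ord f + ord g;
  ordD : forall f g : C, f != 0 -> g != 0 -> f + g != 0 ->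
           Num.min (ord f) (ord g) <= ord (f + g);
  ordC : forall a : k, a != 0 -> ord (a *: 1) = 0;
  ord_surj : exists2 t : C, t != 0 & ord t = 1
}.

HB.instance Definition _ (k : closedFieldType) (C : curve k) :=
  gen_eqMixin (point C).
HB.instance Definition _ (k : closedFieldType) (C : curve k) :=
  gen_choiceMixin (point C).

Section Curve.
Variables (k : closedFieldType) (C : curve k).

Definition divisor := {freeg (point C)}.

Definition ord_ge (P : point C) (n : int) (f : C) : Prop :=
  f = 0 \/ n <= ord P f.

Definition h0 (D : divisor) : set C :=
  [set f | forall P : point C, ord_ge P (- coeff P D) f].

(* The element e generates the stalk of O(D) at P. *)
Definition local_gen (P : point C) (D : divisor) (e : C) : Prop :=
  e != 0 /\ ord P e = - coeff P D.

(* For W in H^0(O(D)) and E effective, the subspace W(-E). *)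
Definition vanishing_along (W : set C) (D E : divisor) : set C :=
  W `&` h0 (D - E).

(* The orders of vanishing at P of the elements of W in H^0(O(D)). *)
Definition vanishing_orders (W : set C) (D : divisor) (P : point C) : set nat :=
  [set n | exists f, [/\ W f, f != 0 & ord P f + coeff P D = n%:Z]].

End Curve.

(* The components are disjoint apart from the nodes A, joining ptA1 and ptA2, *)
(* and B, joining ptB2 and ptB3.                                              *)
Record chain3 (k : closedFieldType) := Chain3 {
  X1 : curve k;
  X2 : curve k;
  X3 : curve k;
  ptA1 : point X1;
  ptA2 : point X2;
  ptB2 : point X2;
  ptB3 : point X3;
  nodes_distinct : ptA2 <> ptB2
}.

(* The gluing at A is the isomorphism of fibres O(div1)|_A -> O(div2)|_A      *)
(* sending the class of the local generator glueA.1 to that of glueA.2;       *)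
(* likewise at B.  Every isomorphism of the fibres arises in this way.        *)
Record inv_sheaf (k : closedFieldType) (X : chain3 k) := InvSheaf {
  div1 : divisor (X1 X);
  div2 : divisor (X2 X);
  div3 : divisor (X3 X);
  glueA : (X1 X * X2 X)%type;
  glueB : (X2 X * X3 X)%type;
  glueA1P : local_gen (ptA1 X) div1 glueA.1;
  glueA2P : local_gen (ptA2 X) div2 glueA.2;
  glueB2P : local_gen (ptB2 X) div2 glueB.1;
  glueB3P : local_gen (ptB3 X) div3 glueB.2
}.

(* f in H^0(O(D)) and g in H^0(O(E)) have the same value at the node joining  *)
(* P and Q, the class of e in O(D)|_P being identified with that of e' in     *)
(* O(E)|_Q: modulo the maximal ideals, f = c e and g = c e' for some c in k.  *)
Definition agree (k : closedFieldType) (C C' : curve k)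
    (P : point C) (D : divisor C) (Q : point C') (E : divisor C')
    (e : C * C') (f : C) (g : C') : Prop :=
  exists c : k, ord_ge P (1 - coeff P D) (f - c *: e.1) /\
                ord_ge Q (1 - coeff Q E) (g - c *: e.2).

Inductive component := Comp1 | Comp2 | Comp3.

Section Chain.
Variables (k : closedFieldType) (X : chain3 k).

(* Triples of rational functions on the components. *)
Definition sect : lmodType k := (X1 X * X2 X * X3 X)%type.
Implicit Types (L : inv_sheaf X) (V : set sect) (s : sect).

Definition H0 L : set sect :=
  [set s | [/\ h0 (div1 L) s.1.1, h0 (div2 L) s.1.2, h0 (div3 L) s.2,
    agree (ptA1 X) (div1 L) (ptA2 X) (div2 L) (glueA L) s.1.1 s.1.2 &
    agree (ptB2 X) (div2 L) (ptB3 X) (div3 L) (glueB L) s.1.2 s.2]].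

(* Restriction to X_q, resp. to X_q^c, followed by extension by zero. *)
Definition ext_comp (q : component) s : sect :=
  match q with
  | Comp1 => (s.1.1, 0, 0)
  | Comp2 => (0, s.1.2, 0)
  | Comp3 => (0, 0, s.2)
  end.
Definition ext_compl (q : component) s : sect :=
  match q with
  | Comp1 => (0, s.1.2, s.2)
  | Comp2 => (s.1.1, 0, s.2)
  | Comp3 => (s.1.1, s.1.2, 0)
  end.

(* V^{X_q,0} and V^{X_q^c,0} *)
Definition van_comp (q : component) V : set sect :=
  V `&` [set s | ext_comp q s = 0].
Definition van_compl (q : component) V : set sect :=
  V `&` [set s | ext_compl q s = 0].

(* The linear series on X_q defined by V. *)
Definition series1 V : set (X1 X) := [set s.1.1 | s in V].
Definition series2 V : set (X2 X) := [set s.1.2 | s in V].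
Definition series3 V : set (X3 X) := [set s.2 | s in V].

End Chain.

(* The pair (i, l) stands for the multidegree (i, d - i - l, l).  The twists  *)
(* are equalities of subsheaves of the constant sheaves of rational functions *)
(* on the components.  The gluing at A depends only on i and that at B only   *)
(* on l, which is what makes the identifications of the restrictions of       *)
(* L_d and L_d~(- X_q \cap X_q^c) to X_q^c equalities; this pins down         *)
(* L_il up to isomorphism.                                                    *)
Definition is_twist_family (k : closedFieldType) (X : chain3 k) (d : nat)
    (L : inv_sheaf X) (Ltw : nat -> nat -> inv_sheaf X) : Prop :=
  [/\ forall i l, (i + l <= d)%N ->
        [/\ div1 (Ltw i l) = div1 L - << (d - i)%N%:Z *g ptA1 X >>,
            div2 (Ltw i l) = div2 L + << (d - i)%N%:Z *g ptA2 X >>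
                                    - << l%:Z *g ptB2 X >> &
            div3 (Ltw i l) = div3 L + << l%:Z *g ptB3 X >>],
      forall i l l', (i + l <= d)%N -> (i + l' <= d)%N ->
        glueA (Ltw i l) = glueA (Ltw i l'),
      forall i i' l, (i + l <= d)%N -> (i' + l <= d)%N ->
        glueB (Ltw i l) = glueB (Ltw i' l) &
      Ltw d 0%N = L].

(* With (i, l) the multidegree d and (i', l') the multidegree d~ obtained     *)
(* from it by means of X_q; both are required to be nonnegative.              *)
Definition is_tilde (d : nat) (q : component) (i l i' l' : nat) : Prop :=
  [/\ (i + l <= d)%N, (i' + l' <= d)%N &
      match q with
      | Comp1 => i = i'.+1 /\ l' = l
      | Comp2 => i' = i.+1 /\ l' = l.+1
      | Comp3 => i' = i /\ l = l'.+1
      end].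

(* phi_{d,d~} and phi_{d~,d}, where d~ is obtained from d by means of X_q *)
Notation phi_to_tilde := ext_compl (only parsing).
Notation phi_from_tilde := ext_comp (only parsing).

Section LimitLinearSeries.
Variables (k : closedFieldType) (X : chain3 k) (d r : nat).
Variable (Ltw : nat -> nat -> inv_sheaf X).
Variables (V1 V2 V3 : set (sect X)).
Implicit Types (V : nat -> nat -> set (sect X)).

(* From (d,0,0) to (0,d,0) each step is a phi_to_tilde for X_1, and from      *)
(* (0,0,d) to (0,d,0) each step is a phi_to_tilde for X_3.                    *)
Definition linked : Prop :=
  [/\ iter d (phi_to_tilde Comp1) @` V1 `<=` V2,
      iter d (phi_from_tilde Comp1) @` V2 `<=` V1,
      iter d (phi_from_tilde Comp3) @` V2 `<=` V3 &
      iter d (phi_to_tilde Comp3) @` V3 `<=` V2].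

Definition kernel (i l : nat) : set (sect X) :=
  H0 (Ltw i l) `&` [set s |
    [/\ vanishing_along (series1 V1) (div1 (Ltw d 0%N))
          << (d - i)%N%:Z *g ptA1 X >> s.1.1,
        vanishing_along (series2 V2) (div2 (Ltw 0%N 0%N))
          (<< i%:Z *g ptA2 X >> + << l%:Z *g ptB2 X >>) s.1.2 &
        vanishing_along (series3 V3) (div3 (Ltw 0%N d))
          << (d - l)%N%:Z *g ptB3 X >> s.2]].

Definition is_collection V : Prop :=
  forall i l, (i + l <= d)%N -> subspace (V i l) /\ V i l `<=` H0 (Ltw i l).

Definition is_limit_linear_series V : Prop :=
  [/\ is_collection V,
      forall i l, (i + l <= d)%N -> has_dim (V i l) r.+1 &
      forall q i l i' l', is_tilde d q i l i' l' ->
        phi_to_tilde q @` V i l `<=` V i' l' /\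
        phi_from_tilde q @` V i' l' `<=` V i l].

Definition is_exact V : Prop :=
  forall q i l i' l', is_tilde d q i l i' l' ->
    phi_to_tilde q @` V i l = van_comp q (V i' l') /\
    phi_from_tilde q @` V i' l' = van_compl q (V i l).

Definition is_exact_extension V : Prop :=
  [/\ is_limit_linear_series V, is_exact V &
      [/\ V d 0%N = V1, V 0%N 0%N = V2 & V 0%N d = V3]].

Definition construction_step V (i l : nat) : Prop :=
  let V'' := V i.-1 l in
  let W := add_space (van_compl Comp2 V'') (van_compl Comp3 V'') in
  exists m n beta : nat,
    [/\ has_dim (van_comp Comp1 V'') m, has_dim W n, m = (n + beta)%N &
      exists u v : 'I_beta -> sect X,
        [/\ lin_indep u /\ (forall j, van_comp Comp1 V'' (u j)),
            is_direct_sum (van_comp Comp1 V'') W (lin_span u),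
            forall j, kernel i l (v j),
            forall j, phi_to_tilde Comp1 (v j) = u j &
            V i l = add_space
              (add_space
                 (if (0 < l)%N then phi_to_tilde Comp2 @` V i.-1 l.-1
                  else [set 0])
                 (if (i + l < d)%N then phi_to_tilde Comp3 @` V i l.+1
                  else [set 0]))
              (lin_span v)]].

Definition is_constructed V : Prop :=
  [/\ forall l, (l <= d)%N -> V 0%N l = kernel 0 l,
      V d 0%N = V1 &
      forall i l, (0 < i < d)%N -> (l <= d - i)%N ->
        construction_step V i l].

End LimitLinearSeries.

(* Main.v *)
From HB Require Import structures.
Require Import Defs.
From mathcomp Require Import all_boot all_order all_algebra.
From mathcomp Require Import boolp classical_sets functions.
From mathcomp Require Import freeg zify ring.

Set Implicit Arguments.
Unset Strict Implicit.
Unset Printing Implicit Defensive.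

Import Order.TTheory GRing.Theory Num.Theory.

Local Open Scope classical_set_scope.
Local Open Scope ring_scope.

(** Write [(s1, s2, s3)] for a section, and say that two neighbouring spaces
    [V_d] and [V_d~] are exact when the two maps between them satisfy the
    conditions of exactness: each image is the kernel of the other map.  Then
    both spaces have the same dimension, namely the sum of the dimensions of
    the two images ([exact_pair_dim]).

    The construction adds one space [V_{i,l}] at a time, when its neighbours
    [V'] at [(i-1,l-1)], [V''] at [(i-1,l)] and [V'''] at [(i,l+1)] are known
    and exact with each other.  Elements of the first two summands have the
    form [(p1, 0, p3)] and [(q1, q2, 0)].  Exactness of [V''] with [V'] and
    [V'''] says that the possible [(0, 0, p3)] and [(0, q2, 0)] are exactly the
    sections of this form in [V''] ([from_left_image], [from_right_image]) and
    that the possible [(p1, 0, 0)] and [(q1, 0, 0)] are exactly the first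
    components of [V''] ([from_left_ker], [ker_from_left] and their mirror
    images).  The [v_m] supply the rest of [V''^{X_1,0}]; as the [u_m] are
    independent modulo the first two contributions, a section of [V_{i,l}] whose
    image has no [u]-part has no [v]-part either ([built_decomp]).  All three
    exactness relations of [V_{i,l}] follow, four equalities by this
    decomposition and two by counting dimensions ([built_exact1],
    [built_exact2], [built_exact3]).  Conversely, in an exact extension the map
    from [V_{i,l}] to [V''] has image [V''^{X_1,0}] and a kernel that is
    contained in the sum of the first two summands, so [V_{i,l}] arises by the
    construction ([exact_is_built]).

    This induction must be started, supported along the boundary, and ended.

    Row 0: refinedness says that the vanishing sequences on the two sides of a
    node are complementary, so that a section on one component always extends
    across the node ([refined_lift]).  Hence neighbouring spaces [K_{0l}] are
    exact with each other ([kernel_row0_exact]), the ends of the row are [V2]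
    and [V3] ([kernel00], [kernel0d]), and all of row 0 has dimension [r+1].

    Boundary: a missing neighbour would have contributed sections [(0, 0, s3)]
    if [l = 0], or [(0, s2, 0)] if [i + l = d].  There are none: [s3] would
    vanish to order [d+1] at [B] ([kernel_top3]), and [s2] would be a section of
    a sheaf of degree [-1] ([kernel_top2]).

    Last row: exactness of [V1] with the space at [(d-1,0)] follows from one
    inclusion for each of the two equalities and equality of the dimensions
    ([exact_last_row]).

    The statement about negative degree, [deg_ge0], is proved from the
    definition of a point as a discrete valuation.  If [f] had more zeros than
    poles, there would be more functions independent over [k(f)] than [f] has
    poles, obtained by approximation at the zeros ([independent_over]); their
    products with the powers of [f] would outgrow the space of functions with
    the corresponding poles ([dim_poles_within]).  The bound on that space
    needs the residue fields to be [k] ([residue]) and every nonconstant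
    function to have a pole ([pole_exists]).  The latter is shown with a
    maximal subring in which a given transcendental function is not invertible:
    it is a valuation ring, and it is discrete.  The finiteness underlying all
    this is that the function field is finite over [k(h)] for every
    transcendental [h] ([finite_over]). *)

(* [point] is also the base point of a pointed type. *)
Local Notation point := Defs.point.

(** * Linear algebra of subspaces *)

Section LinearAlgebraTheory.
Variables (k : fieldType) (M : lmodType k).
Implicit Types (U S : set M).

Lemma subspaceP U :
  subspace U <-> U 0 /\ forall a x y, U x -> U y -> U (a *: x + y).
Proof.
split=> [[U0 Ul]|[U0 Ul]].
  split=> [|a x y Ux Uy]; first exact/set_mem/U0.
  by apply/set_mem/Ul; exact/mem_set.
split=> [|a x y Ux Uy]; first exact/mem_set.
by apply/mem_set/Ul; exact/set_mem.
Qed.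

Section Closure.
Variables (U : set M) (sU : subspace U).

Lemma sub0 : U 0.
Proof. by case/subspaceP: sU. Qed.

Lemma subD x y : U x -> U y -> U (x + y).
Proof.
by case/subspaceP: sU => _ Ul Ux Uy; rewrite -[x]scale1r; exact: Ul.
Qed.

Lemma subZ a x : U x -> U (a *: x).
Proof.
case/subspaceP: sU => U0 Ul Ux; rewrite -[a *: x]addr0; exact: Ul.
Qed.

Lemma subN x : U x -> U (- x).
Proof. by move=> Ux; rewrite -scaleN1r; exact: subZ. Qed.

Lemma subB x y : U x -> U y -> U (x - y).
Proof. by move=> Ux Uy; apply: subD => //; exact: subN. Qed.

Lemma sub_sum (I : finType) (v : I -> M) :
  (forall i, U (v i)) -> U (\sum_i v i).
Proof.
by move=> Uv; elim/big_ind: _ => // [|x y]; [exact: sub0 | exact: subD].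
Qed.

Lemma sub_comb (I : finType) (c : I -> k) (v : I -> M) :
  (forall i, U (v i)) -> U (\sum_i c i *: v i).
Proof. by move=> Uv; apply: sub_sum => i; exact: subZ. Qed.

End Closure.

Lemma subspace_span n (e : 'I_n -> M) : subspace (lin_span e).
Proof.
apply/subspaceP; split.
  by exists (fun=> 0) => //; rewrite big1 // => i _; rewrite scale0r.
move=> a _ _ [c _ <-] [c' _ <-]; exists (fun i => a * c i + c' i) => //.
rewrite scaler_sumr -big_split; apply: eq_bigr => i _.
by rewrite scalerA scalerDl.
Qed.

Lemma span_gen n (e : 'I_n -> M) i : lin_span e (e i).
Proof.
exists (fun j => (j == i)%:R) => //.
rewrite (bigD1 i) //= eqxx scale1r big1 ?addr0 // => j /negbTE ->.
by rewrite scale0r.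
Qed.

Lemma subspace_dim_sub U n : has_dim U n -> subspace U.
Proof. by case=> e _ ->; exact: subspace_span. Qed.

Lemma lin_dep_card (J I : finType) (e : J -> M) (v : I -> M) :
  (forall i, exists a : J -> k, v i = \sum_j a j *: e j) -> (#|J| < #|I|)%N ->
  exists2 c : I -> k, (exists i, c i != 0) & \sum_i c i *: v i = 0.
Proof.
move=> /choice [a aE] ltJI.
pose A := \matrix_(i < #|I|, j < #|J|) a (enum_val i) (enum_val j).
have kerN0 : kermx A != 0.
  rewrite -mxrank_eq0 mxrank_ker subn_eq0 -ltnNge.
  exact: leq_ltn_trans (rank_leq_col A) ltJI.
have /rowV0Pn [w /sub_kermxP wA /rV0Pn [i wi]] := kerN0.
exists (fun i => w 0 (enum_rank i)).
  by exists (enum_val i); rewrite enum_valK.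
under eq_bigr do rewrite aE scaler_sumr.
rewrite exchange_big big1 //= => j _.
under eq_bigr do rewrite scalerA.
rewrite -scaler_suml.
suff -> : \sum_i w 0 (enum_rank i) * a i j = 0 by rewrite scale0r.
have /matrixP/(_ 0 (enum_rank j)) := wA; rewrite !mxE => {2}<-.
rewrite [RHS](reindex_onto (@enum_rank I) enum_val) /=; last first.
  by move=> l _; rewrite enum_valK.
apply: eq_big => [l|l _]; first by rewrite enum_rankK eqxx.
by rewrite mxE !enum_rankK.
Qed.

Definition indep_mod S n (u : 'I_n -> M) :=
  forall c : 'I_n -> k, S (\sum_i c i *: u i) -> forall i, c i = 0.

Lemma indep_leq n (e : 'I_n -> M) m (u : 'I_m -> M) :
  (forall i, lin_span e (u i)) -> lin_indep u -> (m <= n)%N.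
Proof.
move=> ue iu; rewrite leqNgt; apply/negP => ltnm.
have [||c [i ci] /iu c0] := @lin_dep_card _ _ e u; rewrite ?card_ord //.
  by move=> i; have [c _ <-] := ue i; exists c.
by rewrite c0 eqxx in ci.
Qed.

Lemma has_dim_uniq U m n : has_dim U m -> has_dim U n -> m = n.
Proof.
move=> [e ie Ue] [f jf Uf]; apply/eqP; rewrite eqn_leq.
apply/andP; split.
  by apply: (@indep_leq _ f _ e) => // i; rewrite -Uf Ue; exact: span_gen.
by apply: (@indep_leq _ e _ f) => // i; rewrite -Ue Uf; exact: span_gen.
Qed.

Definition cat_fam m n (e : 'I_m -> M) (u : 'I_n -> M) (i : 'I_(m + n)) :=
  match fintype.split i with inl j => e j | inr j => u j end.

Lemma cat_famE m n (e : 'I_m -> M) (u : 'I_n -> M) (c : 'I_(m + n) -> k) :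
  \sum_i c i *: cat_fam e u i =
  \sum_i c (lshift n i) *: e i + \sum_j c (rshift m j) *: u j.
Proof.
rewrite big_split_ord; congr (_ + _); apply: eq_bigr => i _.
  by rewrite /cat_fam -[lshift n i]/(unsplit (inl i)) unsplitK.
by rewrite /cat_fam -[rshift m i]/(unsplit (inr i)) unsplitK.
Qed.

(** A basis of [S] followed by a basis of a complement is a basis. *)
Lemma has_dim_add S m n (u : 'I_n -> M) :
  has_dim S m -> indep_mod S u -> has_dim (add_space S (lin_span u)) (m + n).
Proof.
move=> [e ie SE] iu; exists (cat_fam e u).
  move=> c; rewrite cat_famE => /eqP; rewrite addr_eq0 => /eqP eqeu.
  have cr j : c (rshift m j) = 0.
    move: j; apply: iu; rewrite -[X in S X]opprK -eqeu.
    apply: (subN (subspace_dim_sub _)); first by exists e.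
    by rewrite SE; exists (fun i => c (lshift n i)).
  have cl i : c (lshift n i) = 0.
    move: i; apply: ie; rewrite eqeu big1 ?oppr0 // => j _.
    by rewrite cr scale0r.
  by move=> i; rewrite -[i]fintype.splitK; case: (fintype.split i) => j /=.
rewrite SE; apply/seteqP; split=> [_ [_ [a _ <-] [_ [b _ <-] <-]]|_ [c _ <-]].
  exists (fun i => match fintype.split i with inl j => a j | inr j => b j end) => //.
  rewrite cat_famE; congr (_ + _); apply: eq_bigr => i _.
    by rewrite -[lshift n i]/(unsplit (inl i)) unsplitK.
  by rewrite -[rshift m i]/(unsplit (inr i)) unsplitK.
rewrite cat_famE; eexists; last eexists; last reflexivity.
  by exists (fun i => c (lshift n i)).
by exists (fun i => c (rshift m i)).
Qed.

(** A largest family of vectors of [U] independent modulo [S] spans [U]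
    together with [S]. *)
Lemma complement_exists T U S n :
    has_dim T n -> U `<=` T -> subspace U -> subspace S -> S `<=` U ->
  exists b (u : 'I_b -> M),
    [/\ forall j, U (u j), indep_mod S u & U = add_space S (lin_span u)].
Proof.
move=> [e ie TE] UT sU sS SU.
pose P b := `[< exists u : 'I_b -> M, (forall j, U (u j)) /\ indep_mod S u >].
have P0 : exists b, P b.
  exists 0%N; apply/asboolP; exists (fun=> 0); split=> [[]//|c _ []//].
have Pn b : P b -> (b <= n)%N.
  move=> /asboolP [u [Uu iu]]; apply: (@indep_leq _ e _ u).
    by move=> i; rewrite -TE; exact: UT.
  by move=> c c0; apply: iu; rewrite c0; exact: sub0.
case: (ex_maxnP P0 Pn) => b /asboolP [u [Uu iu]] bmax.
exists b, u; split=> //; apply/seteqP; split=> [x Ux|_ [s Ss [_ [c _ <-] <-]]].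
  apply: contrapT => xN.
  suff /bmax : P b.+1 by rewrite ltnn.
  apply/asboolP; exists (fun i => oapp u x (unlift ord0 i)); split=> [i|c].
    by case: (unlift ord0 i).
  rewrite big_ord_recl /= unlift_none /=.
  under eq_bigr do rewrite liftK /=.
  move=> Sc.
  have c0 : c ord0 = 0.
    apply/eqP/negPn/negP => c0; apply: xN.
    exists ((c ord0)^-1 *: (c ord0 *: x +
               \sum_(i < b) c (fintype.lift ord0 i) *: u i)); first exact: subZ.
    exists (- ((c ord0)^-1 *: (\sum_(i < b) c (fintype.lift ord0 i) *: u i))).
      apply: (subN (subspace_span _)); apply: (subZ (subspace_span _)).
      by exists (fun i => c (fintype.lift ord0 i)).
    by rewrite scalerDr addrK scalerA mulVf // scale1r.
  move: Sc; rewrite c0 scale0r add0r => Sc i.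
  by case: (unliftP ord0 i) => [j ->|-> //]; exact: (iu (fun j => c (fintype.lift ord0 j))).
by apply: subD => //; [exact: SU | exact: sub_comb].
Qed.

Lemma has_dim0 : has_dim [set 0 : M] 0.
Proof.
exists (fun=> 0) => [c _ []//|].
apply/seteqP; split=> [_ ->|_ [c _ <-] /=]; last by rewrite big_ord0.
by exists (fun=> 0) => //; rewrite big_ord0.
Qed.

Lemma subspace0 : subspace [set 0 : M].
Proof. exact: subspace_dim_sub has_dim0. Qed.

Lemma subspace_has_dim T S n :
  has_dim T n -> S `<=` T -> subspace S -> exists m, has_dim S m.
Proof.
move=> Tn ST sS.
have [|m [u [Su iu SE]]] := complement_exists Tn ST sS subspace0.
  by move=> _ ->; exact: sub0.
by exists m; rewrite SE; apply: (has_dim_add has_dim0).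
Qed.

Lemma has_dim_sub_eq S U n : has_dim S n -> has_dim U n -> S `<=` U -> S = U.
Proof.
move=> Sn Un SU; have sS := subspace_dim_sub Sn; have sU := subspace_dim_sub Un.
have [b [u [_ iu UE]]] := complement_exists Un (@subset_refl _ U) sU sS SU.
have := has_dim_add Sn iu; rewrite -UE => /(has_dim_uniq Un) /eqP.
rewrite -{1}[n]addn0 eqn_add2l => /eqP b0; subst b.
rewrite {Un}UE; apply/seteqP; split=> [s Ss|_ [s Ss [_ [c _ <-] <-]]].
  exists s => //; exists 0; rewrite ?addr0 //; exact: sub0 (subspace_span _).
by rewrite big_ord0 addr0.
Qed.

End LinearAlgebraTheory.

Section RankNullity.
Variables (k : fieldType) (M N : lmodType k) (f : {linear M -> N}).
Implicit Types U : set M.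

Definition ker_in U : set M := U `&` [set x | f x = 0].

Lemma subspace_ker U : subspace U -> subspace (ker_in U).
Proof.
move=> sU; apply/subspaceP; split=> [|a x y [Ux /= fx] [Uy /= fy]].
  by split=> /=; [exact: sub0 | rewrite linear0].
split=> /=; last by rewrite linearP fx fy scaler0 addr0.
by apply: subD => //; exact: subZ.
Qed.

Lemma subspace_image U : subspace U -> subspace (f @` U).
Proof.
move=> sU; apply/subspaceP; split; first by exists 0; [exact: sub0 | exact: linear0].
move=> a _ _ [x Ux <-] [y Uy <-]; exists (a *: x + y); last exact: linearP.
by apply: subD => //; exact: subZ.
Qed.

Lemma span_image n (u : 'I_n -> M) : f @` lin_span u = lin_span (f \o u).
Proof.
apply/seteqP; split=> [_ [_ [c _ <-] <-]|_ [c _ <-]].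
  by exists c => //; rewrite linear_sum; apply: eq_bigr => i _; rewrite linearZ.
exists (\sum_i c i *: u i); first by exists c.
by rewrite linear_sum; apply: eq_bigr => i _; rewrite linearZ.
Qed.

Lemma indep_mod_ker U n (u : 'I_n -> M) : (forall j, U (u j)) -> subspace U ->
  indep_mod (ker_in U) u <-> lin_indep (f \o u).
Proof.
move=> Uu sU.
have fE (c : 'I_n -> k) : \sum_i c i *: (f \o u) i = f (\sum_i c i *: u i).
  by rewrite linear_sum; apply: eq_bigr => i _; rewrite linearZ.
split=> iu c; rewrite ?fE => cE; apply: iu; last by rewrite fE; case: cE.
by split; [exact: sub_comb | exact: cE].
Qed.

(** Used to transfer the dimension from one space to its neighbour, when the
    dimension of [U] is not known in advance. *)
Lemma dim_ker_image U p q : subspace U ->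
  has_dim (ker_in U) q -> has_dim (f @` U) p -> has_dim U (q + p).
Proof.
move=> sU Kq [w iw wE].
have /choice [u uP] : forall i, exists x, U x /\ f x = w i.
  by move=> i; have [x Ux fx] : (f @` U) (w i); [rewrite wE; exact: span_gen | exists x].
have Uu i : U (u i) by case: (uP i).
have fu : f \o u = w by apply/funext => i; case: (uP i).
rewrite (_ : U = add_space (ker_in U) (lin_span u)).
  by apply: has_dim_add => //; apply/indep_mod_ker; rewrite ?fu.
apply/seteqP; split=> [x Ux|_ [x [Ux _] [_ [c _ <-] <-]]]; last first.
  by apply: subD => //; exact: sub_comb.
have : (f @` U) (f x) by exists x.
rewrite wE -fu -span_image => -[y yu fyx].
exists (x - y); last by exists y => //; rewrite subrK.
split=> /=; last by rewrite linearB fyx subrr.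
by apply: subB => //; case: yu => c _ <-; exact: sub_comb.
Qed.

Lemma rank_nullity U n : has_dim U n ->
  exists p q, [/\ has_dim (f @` U) p, has_dim (ker_in U) q & (q + p)%N = n].
Proof.
move=> Un; have sU := subspace_dim_sub Un.
have KU : ker_in U `<=` U by move=> x [].
have sK := subspace_ker sU.
have [q Kq] := subspace_has_dim Un KU sK.
have [p [u [Uu iu UE]]] := complement_exists Un (@subset_refl _ U) sU sK KU.
exists p, q; split=> //; last first.
  by apply: (has_dim_uniq (U := U)) => //; rewrite UE; exact: has_dim_add.
exists (f \o u); first exact/(indep_mod_ker Uu sU).
rewrite -span_image; apply/seteqP; split=> [_ [x Ux <-]|_ [x [c _ <-] <-]].
  move: Ux; rewrite UE => -[y [_ /= fy] [z zu <-]].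
  by exists z => //; rewrite linearD fy add0r.
by exists (\sum_i c i *: u i) => //; exact: sub_comb.
Qed.

End RankNullity.

(** * Pairs of maps that are exact on two subspaces *)

Section ExactPairs.
Variables (k : fieldType) (M : lmodType k) (f g : {linear M -> M}).
Implicit Types U T : set M.

Lemma dim_le U T m n : has_dim U m -> has_dim T n -> U `<=` T -> (m <= n)%N.
Proof.
move=> [e ie UE] [e' _ TE] UT; apply: (@indep_leq _ _ _ e' _ e) => // i.
by rewrite -TE; apply: UT; rewrite UE; exact: span_gen.
Qed.

(** The maps [f] and [g] stand for the two maps between neighbouring
    multidegrees. *)
Definition exact_pair U T := f @` U = ker_in g T /\ g @` T = ker_in f U.

(** Both dimensions are the sum of those of the two images. *)
Lemma exact_pair_dim U T n : subspace T -> exact_pair U T -> has_dim U n -> has_dim T n.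
Proof.
move=> sT [fU gT] Un; have [p [q [fp kq <-]]] := rank_nullity f Un.
by rewrite addnC; apply: (@dim_ker_image _ _ _ g); rewrite -?fU ?gT.
Qed.

(** On either space, image and kernel have dimensions adding up to [n], so that
    neither inclusion can be strict. *)
Lemma exact_pair_of_dim U T n : has_dim U n -> has_dim T n ->
  ker_in g T `<=` f @` U -> g @` T `<=` ker_in f U -> exact_pair U T.
Proof.
move=> Un Tn kf gk; have [p [q [fp kq Eq]]] := rank_nullity f Un.
have [p' [q' [gp' kq' Eq']]] := rank_nullity g Tn.
have le1 := dim_le kq' fp kf; have le2 := dim_le gp' kq gk.
have pq' : p = q' by lia.
have qp' : q = p' by lia.
subst p q; split; last exact: has_dim_sub_eq gp' kq gk.
by apply/esym; exact: has_dim_sub_eq kq' fp kf.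
Qed.

Lemma exact_pair_of_half U T n : has_dim U n -> has_dim T n ->
  f @` U = ker_in g T -> ker_in f U `<=` g @` T -> exact_pair U T.
Proof.
move=> Un Tn fU kg; split=> //.
have [p [q [fp kq Eq]]] := rank_nullity f Un.
have [p' [q' [gp' kq' Eq']]] := rank_nullity g Tn.
have pq' : p = q' by apply: (has_dim_uniq fp); rewrite fU.
have qp' : q = p' by lia.
by subst q; apply/esym; exact: has_dim_sub_eq kq gp' kg.
Qed.

End ExactPairs.

Lemma exact_pair_sym (k : fieldType) (M : lmodType k) (f g : {linear M -> M}) U T :
  exact_pair f g U T -> exact_pair g f T U.
Proof. by case. Qed.

Section ExtensionByZero.
Variables (k : closedFieldType) (X : chain3 k) (q : component).

Lemma ext_comp_linear : linear (@ext_comp k X q).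
Proof.
by move=> a [[x1 x2] x3] [[y1 y2] y3]; case: q; congr (_, _, _); rewrite /= ?scaler0 ?addr0.
Qed.

Lemma ext_compl_linear : linear (@ext_compl k X q).
Proof.
by move=> a [[x1 x2] x3] [[y1 y2] y3]; case: q; congr (_, _, _); rewrite /= ?scaler0 ?addr0.
Qed.

HB.instance Definition _ :=
  GRing.isLinear.Build k (sect X) (sect X) *:%R (@ext_comp k X q) ext_comp_linear.
HB.instance Definition _ :=
  GRing.isLinear.Build k (sect X) (sect X) *:%R (@ext_compl k X q) ext_compl_linear.

End ExtensionByZero.

(** The condition of [is_exact] for one pair of multidegrees, [T] being
    obtained from [U] by means of [X_q]. *)
Definition exact_at (k : closedFieldType) (X : chain3 k) (q : component)
    (U T : set (sect X)) : Prop :=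
  ext_compl q @` U = van_comp q T /\ ext_comp q @` T = van_compl q U.

Lemma exact_atE (k : closedFieldType) (X : chain3 k) q (U T : set (sect X)) :
  exact_at q U T <-> exact_pair (@ext_compl k X q) (@ext_comp k X q) U T.
Proof. by []. Qed.

Lemma subspace_van_comp (k : closedFieldType) (X : chain3 k) q (V : set (sect X)) :
  subspace V -> subspace (van_comp q V).
Proof. exact: (@subspace_ker _ _ _ (@ext_comp k X q)). Qed.

Lemma subspace_van_compl (k : closedFieldType) (X : chain3 k) q (V : set (sect X)) :
  subspace V -> subspace (van_compl q V).
Proof. exact: (@subspace_ker _ _ _ (@ext_compl k X q)). Qed.

Lemma ext_complD (k : closedFieldType) (X : chain3 k) q (s t : sect X) :
  ext_compl q (s + t) = ext_compl q s + ext_compl q t.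
Proof. exact: linearD. Qed.

Lemma ext_compl_comb (k : closedFieldType) (X : chain3 k) q n (c : 'I_n -> k)
    (v : 'I_n -> sect X) :
  ext_compl q (\sum_j c j *: v j) = \sum_j c j *: ext_compl q (v j).
Proof. by rewrite linear_sum; apply: eq_bigr => j _; exact: linearZ. Qed.

Lemma subspace_ext_comp (k : closedFieldType) (X : chain3 k) q (V : set (sect X)) :
  subspace V -> subspace (ext_comp q @` V).
Proof. exact: (@subspace_image _ _ _ (@ext_comp k X q)). Qed.

(** * One step of the construction *)

Section Step.
Variables (k : closedFieldType) (X : chain3 k) (d : nat).
Variables (V : nat -> nat -> set (sect X)) (i l : nat).
Implicit Types s t : sect X.

(** The summands of the space at [(i+1,l)] that come from [(i,l-1)] and from
    [(i+1,l+1)]; each is zero if its source lies outside the triangle of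
    multidegrees. *)
Definition from_left : set (sect X) :=
  if (0 < l)%N then ext_compl Comp2 @` V i l.-1 else [set 0].
Definition from_right : set (sect X) :=
  if (i.+1 + l < d)%N then ext_compl Comp3 @` V i.+1 l.+1 else [set 0].

Local Notation V'' := (V i l).
Local Notation W := (add_space (van_compl Comp2 V'') (van_compl Comp3 V'')).
Local Notation U := (V i.+1 l).

Hypothesis sV : forall i l, (i + l <= d)%N -> subspace (V i l).
Hypothesis lt_d : (i.+1 < d)%N.
Hypothesis le_d : (i.+1 + l <= d)%N.
(* At the two ends of a row, what the missing neighbour would contribute is zero. *)
Hypothesis bottom_left : l = 0%N -> forall s, V'' s -> s.1.1 = 0 -> s.1.2 = 0 -> s.2 = 0.
Hypothesis bottom_right : (i.+1 + l)%N = d ->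
  forall s, V'' s -> s.1.1 = 0 -> s.2 = 0 -> s.1.2 = 0.
Hypothesis exact_left : (0 < l)%N -> exact_at Comp3 V'' (V i l.-1).
Hypothesis exact_right : (i.+1 + l < d)%N -> exact_at Comp2 V'' (V i.+1 l.+1).

Let sV'' : subspace V''.
Proof. by apply: sV; lia. Qed.
Let sU : subspace U.
Proof. exact: sV. Qed.

Lemma sect_eq (s t : sect X) : s.1.1 = t.1.1 -> s.1.2 = t.1.2 -> s.2 = t.2 -> s = t.
Proof. by case: s t => [[? ?] ?] [[? ?] ?] /= -> -> ->. Qed.

Lemma subspace_from_left : subspace from_left.
Proof.
rewrite /from_left; case: ifP => _; last exact: subspace0.
by apply: subspace_image; apply: sV; lia.
Qed.

Lemma subspace_from_right : subspace from_right.
Proof.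
rewrite /from_right; case: ifP => [lt|_]; last exact: subspace0.
by apply: subspace_image; apply: sV; lia.
Qed.

Lemma from_left2 p : from_left p -> p.1.2 = 0.
Proof. by rewrite /from_left; case: ifP => _; [move=> [s _ <-] | move=> ->]. Qed.

Lemma from_right3 p : from_right p -> p.2 = 0.
Proof. by rewrite /from_right; case: ifP => _; [move=> [s _ <-] | move=> ->]. Qed.

(** Exactness between [(i,l)] and [(i,l-1)] provides the sections supported on
    [X_3]; if [l = 0], there are none. *)
Lemma from_left_image : ext_compl Comp1 @` from_left = van_compl Comp3 V''.
Proof.
rewrite /from_left; case: ifP => [/exact_left [_ <-]|/negbT l0].
  apply/seteqP; split=> [_ [_ [s Vs <-] <-]|_ [s Vs <-]]; first by exists s.
  by exists (ext_compl Comp2 s) => //; exists s.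
apply/seteqP; split=> [_ [_ -> <-]|s [Vs /= [s1 s2]]].
  by split; [exact: (sub0 sV'') |].
exists 0 => //; apply: sect_eq; rewrite //= ?s1 ?s2 //.
by apply/esym/bottom_left => //; lia.
Qed.

Lemma from_right_image : ext_compl Comp1 @` from_right = van_compl Comp2 V''.
Proof.
rewrite /from_right; case: ifP => [/exact_right [_ <-]|/negbT l0].
  apply/seteqP; split=> [_ [_ [s Vs <-] <-]|_ [s Vs <-]]; first by exists s.
  by exists (ext_compl Comp3 s) => //; exists s.
apply/seteqP; split=> [_ [_ -> <-]|s [Vs /= [s1 s2]]].
  by split; [exact: (sub0 sV'') |].
exists 0 => //; apply: sect_eq; rewrite //= ?s1 ?s2 //.
by apply/esym/bottom_right => //; lia.
Qed.

(** If [(s1, s2, 0)] is a section at [(i,l-1)], it lifts to [(i,l)] by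
    exactness, so [s1] is also the first component of a section at [(i,l)]. *)
Lemma from_left_ker p : from_left p -> p.2 = 0 -> (ext_comp Comp1 @` V'') p.
Proof.
rewrite /from_left; case: ifP => [/exact_left [E _] [s Vs <-] /= s3|_ -> _]; last first.
  by exists 0; [exact: sub0 | exact: linear0].
have [t Vt ts] : (ext_compl Comp3 @` V'') s by rewrite E; split; rewrite //= s3.
by exists t => //; rewrite -ts.
Qed.

Lemma from_right_ker p : from_right p -> p.1.2 = 0 -> (ext_comp Comp1 @` V'') p.
Proof.
rewrite /from_right; case: ifP => [/exact_right [E _] [s Vs <-] /= s2|_ -> _]; last first.
  by exists 0; [exact: sub0 | exact: linear0].
have [t Vt ts] : (ext_compl Comp2 @` V'') s by rewrite E; split; rewrite //= s2.
by exists t => //; rewrite -ts.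
Qed.

Lemma ker_from_left : (0 < l)%N -> ext_comp Comp1 @` V'' `<=` from_left.
Proof.
move=> l0 _ [t Vt <-]; rewrite /from_left l0; have [E _] := exact_left l0.
have [Vs _] : van_comp Comp3 (V i l.-1) (ext_compl Comp3 t) by rewrite -E; exists t.
by exists (ext_compl Comp3 t).
Qed.

Lemma ker_from_right : (i.+1 + l < d)%N -> ext_comp Comp1 @` V'' `<=` from_right.
Proof.
move=> lt; move=> _ [t Vt <-]; rewrite /from_right lt; have [E _] := exact_right lt.
have [Vs _] : van_comp Comp2 (V i.+1 l.+1) (ext_compl Comp2 t) by rewrite -E; exists t.
by exists (ext_compl Comp2 t).
Qed.

(** Both neighbours cannot be missing at once, because [i+1 < d]. *)
Lemma ker_from : ext_comp Comp1 @` V'' `<=` add_space from_left from_right.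
Proof.
move=> p Vp; case: (posnP l) => [l0|l0].
  exists 0; first exact: (sub0 subspace_from_left).
  by exists p; rewrite ?add0r //; apply: ker_from_right => //; rewrite l0 addn0.
exists p; first exact: ker_from_left.
by exists 0; rewrite ?addr0 //; exact: (sub0 subspace_from_right).
Qed.

Lemma complement_van_comp1 : W `<=` van_comp Comp1 V''.
Proof.
move=> _ [a [Va /= [a1 a3]] [b [Vb /= [b1 b2]] <-]].
by split=> /=; rewrite ?a1 ?b1 ?addr0 //; exact: subD.
Qed.

Section Built.
Variables (beta : nat) (u v : 'I_beta -> sect X).
Hypothesis u_ind : lin_indep u.
Hypothesis u_dir : is_direct_sum (van_comp Comp1 V'') W (lin_span u).
Hypothesis uv : forall j, ext_compl Comp1 (v j) = u j.
Hypothesis UE : U = add_space (add_space from_left from_right) (lin_span v).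

Let compl1_span (c : 'I_beta -> k) :
  ext_compl Comp1 (\sum_j c j *: v j) = \sum_j c j *: u j.
Proof. by rewrite ext_compl_comb; apply: eq_bigr => j _; rewrite uv. Qed.

Lemma built_sum p q c : from_left p -> from_right q -> U (p + q + \sum_j c j *: v j).
Proof.
move=> Sp Sq; rewrite UE; exists (p + q); first by exists p => //; exists q.
by exists (\sum_j c j *: v j) => //; exists c.
Qed.

Lemma built_left : from_left `<=` U.
Proof.
move=> p Sp; have := built_sum (fun=> 0) Sp (sub0 subspace_from_right).
by rewrite big1 ?addr0 // => j _; rewrite scale0r.
Qed.

Lemma built_right : from_right `<=` U.
Proof.
move=> q Sq; have := built_sum (fun=> 0) (sub0 subspace_from_left) Sq.
by rewrite big1 ?addr0 ?add0r // => j _; rewrite scale0r.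
Qed.

Lemma compl1_complement p q : from_left p -> from_right q -> W (ext_compl Comp1 (p + q)).
Proof.
move=> Sp Sq; exists (ext_compl Comp1 q); first by rewrite -from_right_image; exists q.
exists (ext_compl Comp1 p); first by rewrite -from_left_image; exists p.
by rewrite addrC ext_complD.
Qed.

Lemma subspace_complement : subspace W.
Proof.
have s2 : subspace (van_compl Comp2 V'') by exact: subspace_van_compl.
have s3 : subspace (van_compl Comp3 V'') by exact: subspace_van_compl.
apply/subspaceP; split.
  by exists 0; [exact: sub0 | exists 0; rewrite ?addr0 //; exact: sub0].
move=> a _ _ [x Vx [y Vy <-]] [x' Vx' [y' Vy' <-]].
exists (a *: x + x'); first by apply: subD => //; exact: subZ.
exists (a *: y + y'); first by apply: subD => //; exact: subZ.
by rewrite scalerDr addrACA.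
Qed.

(** A section of the constructed space whose image lies in the complement of
    the span of the [u j] does not involve the [v j]. *)
Lemma built_decomp x : U x -> W (ext_compl Comp1 x) ->
  exists p q, [/\ from_left p, from_right q & x = p + q].
Proof.
rewrite {1}UE => -[_ [p Sp [q Sq <-]] [_ [c _ <-] <-]].
rewrite ext_complD compl1_span => Wx.
have Wc : W (\sum_j c j *: u j).
  have := subB subspace_complement Wx (compl1_complement Sp Sq).
  by rewrite addrAC subrr add0r.
have c0 : \sum_j c j *: u j = 0.
  have [_ WI] := u_dir; suff : [set 0] (\sum_j c j *: u j) by [].
  by rewrite -WI; split=> //; exists c.
exists p, q; split=> //; rewrite big1 ?addr0 // => j _.
by rewrite (u_ind c0) scale0r.
Qed.

(** The images of the three summands are the two parts of the complement [W]
    and the span of the [u j]. *)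
Lemma built_exact1_compl : ext_compl Comp1 @` U = van_comp Comp1 V''.
Proof.
apply/seteqP; split.
  move=> _ [x Ux <-]; move: Ux; rewrite UE => -[_ [p Sp [q Sq <-]] [_ [c _ <-] <-]].
  rewrite ext_complD compl1_span; have [-> _] := u_dir.
  exists (ext_compl Comp1 (p + q)); first exact: compl1_complement.
  by exists (\sum_j c j *: u j) => //; exists c.
have [-> _] := u_dir; move=> _ [_ [a + [b + <-]] [_ [c _ <-] <-]].
rewrite -from_left_image -from_right_image => -[q Sq <-] [p Sp <-].
exists (p + q + \sum_j c j *: v j); first exact: built_sum.
by rewrite !ext_complD compl1_span [X in X + _]addrC.
Qed.

(** A section of the form [(x1, 0, 0)] in the constructed space is a sum of
    [(p1, 0, 0)] and [(q1, 0, 0)], both of which come from first components at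
    [(i,l)]. *)
Lemma built_exact1 : exact_at Comp1 U V''.
Proof.
split; first exact: built_exact1_compl.
apply/seteqP; split=> [p Vp|x [Ux /= [x2 x3]]].
  have [a Sa [b Sb ab]] := ker_from Vp; split.
    by rewrite -ab; apply: subD => //; [exact: built_left | exact: built_right].
  by case: Vp => s _ <-.
have [|p [q [Sp Sq xE]]] := built_decomp Ux.
  by rewrite /= x2 x3; exact: (sub0 subspace_complement).
have p3 : p.2 = 0 by move: x3; rewrite xE /= (from_right3 Sq) addr0.
have q2 : q.1.2 = 0 by move: x2; rewrite xE /= (from_left2 Sp) add0r.
rewrite xE; apply: (subD (subspace_ext_comp Comp1 sV'')).
  exact: from_left_ker.
exact: from_right_ker.
Qed.

Lemma built_left_exact : (0 < l)%N -> ext_compl Comp2 @` V i l.-1 = van_comp Comp2 U.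
Proof.
move=> l0; have SE : from_left = ext_compl Comp2 @` V i l.-1 by rewrite /from_left l0.
rewrite -SE; apply/seteqP; split=> [p Sp|x [Ux /= [x2]]].
  by split; [exact: built_left | rewrite /= (from_left2 Sp)].
have [|p [q [Sp Sq xE]]] := built_decomp Ux.
  exists 0; first by split; [exact: (sub0 sV'') | exact: linear0].
  exists (ext_compl Comp1 x); last by rewrite add0r.
  have : (ext_compl Comp1 @` U) (ext_compl Comp1 x) by exists x.
  by rewrite built_exact1_compl => -[Vx _]; split=> //=; rewrite x2.
have q2 : q.1.2 = 0 by move: x2; rewrite xE /= (from_left2 Sp) add0r.
rewrite xE; apply: (subD subspace_from_left) => //.
by apply: ker_from_left => //; exact: from_right_ker.
Qed.

Lemma built_right_exact : (i.+1 + l < d)%N ->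
  ext_compl Comp3 @` V i.+1 l.+1 = van_comp Comp3 U.
Proof.
move=> lt; have SE : from_right = ext_compl Comp3 @` V i.+1 l.+1 by rewrite /from_right lt.
rewrite -SE; apply/seteqP; split=> [p Sp|x [Ux /= [x3]]].
  by split; [exact: built_right | rewrite /= (from_right3 Sp)].
have [|p [q [Sp Sq xE]]] := built_decomp Ux.
  exists (ext_compl Comp1 x); last first.
    by exists 0; rewrite ?addr0 //; split; [exact: (sub0 sV'') | exact: linear0].
  have : (ext_compl Comp1 @` U) (ext_compl Comp1 x) by exists x.
  by rewrite built_exact1_compl => -[Vx _]; split=> //=; rewrite x3.
have p3 : p.2 = 0 by move: x3; rewrite xE /= (from_right3 Sq) addr0.
rewrite xE; apply: (subD subspace_from_right) => //.
by apply: ker_from_right => //; exact: from_left_ker.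
Qed.

Variable n : nat.
Hypothesis V''_dim : has_dim V'' n.

Lemma built_dim : has_dim U n.
Proof. by apply: exact_pair_dim V''_dim => //; exact/exact_pair_sym/built_exact1. Qed.

(** Lifting twice, from [V i l.-1] to [V i l] and from there to [V i.+1 l],
    gives one of the two inclusions; the other follows by counting dimensions. *)
Lemma built_exact2 : (0 < l)%N -> has_dim (V i l.-1) n -> exact_at Comp2 (V i l.-1) U.
Proof.
move=> l0 V'_dim; apply/exact_atE.
apply: (exact_pair_of_half V'_dim built_dim); first exact: built_left_exact.
move=> s [Vs /= [s1 s3]]; have [E _] := exact_left l0.
have [t Vt ts] : (ext_compl Comp3 @` V'') s by rewrite E; split; rewrite //= s3.
have [y Uy yt] : (ext_compl Comp1 @` U) t.
  by rewrite built_exact1_compl; split=> //=; move: s1; rewrite -ts /= => ->.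
exists y => //; apply: sect_eq; rewrite /= ?s1 ?s3 //.
by rewrite -ts /= -yt.
Qed.

Lemma built_exact3 : (i.+1 + l < d)%N -> has_dim (V i.+1 l.+1) n ->
  exact_at Comp3 (V i.+1 l.+1) U.
Proof.
move=> lt V'_dim; apply/exact_atE.
apply: (exact_pair_of_half V'_dim built_dim); first exact: built_right_exact.
move=> s [Vs /= [s1 s2]]; have [E _] := exact_right lt.
have [t Vt ts] : (ext_compl Comp2 @` V'') s by rewrite E; split; rewrite //= s2.
have [y Uy yt] : (ext_compl Comp1 @` U) t.
  by rewrite built_exact1_compl; split=> //=; move: s1; rewrite -ts /= => ->.
exists y => //; apply: sect_eq; rewrite /= ?s1 ?s2 //.
by rewrite -ts /= -yt.
Qed.

End Built.

(** In an exact extension the image of [V i.+1 l] in [V i l] is known, and its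
    kernel is already contained in what comes from the two neighbours. *)
Lemma exact_is_built n : has_dim V'' n -> exact_at Comp1 U V'' ->
    from_left `<=` U -> from_right `<=` U ->
  exists m p beta : nat,
    [/\ has_dim (van_comp Comp1 V'') m, has_dim W p, m = (p + beta)%N &
      exists u v : 'I_beta -> sect X,
        [/\ lin_indep u /\ (forall j, van_comp Comp1 V'' (u j)),
            is_direct_sum (van_comp Comp1 V'') W (lin_span u),
            forall j, U (v j),
            forall j, ext_compl Comp1 (v j) = u j &
            U = add_space (add_space from_left from_right) (lin_span v)]].
Proof.
move=> V''_dim [U1 U1'] SU2 SU3.
have VV : van_comp Comp1 V'' `<=` V'' by move=> s [].
have sVc : subspace (van_comp Comp1 V'') by exact: subspace_van_comp.
have sW := subspace_complement.
have [b [u [Vu iu VE]]] := complement_exists V''_dim VV sVc sW complement_van_comp1.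
have [p Wp] := subspace_has_dim V''_dim (subset_trans complement_van_comp1 VV) sW.
have Vm := has_dim_add Wp iu; rewrite -VE in Vm.
have /choice [v vP] : forall j, exists x, U x /\ ext_compl Comp1 x = u j.
  by move=> j; have := Vu j; rewrite -U1 => -[x Ux xu]; exists x.
exists (p + b)%N, p, b; split=> //; exists u, v; split.
- split=> // c c0; apply: iu; rewrite c0; exact: sub0.
- split=> //; apply/seteqP; split=> [x [Wx [c _ cE]]|_ ->]; last first.
    by split; [exact: sub0 | exact: (sub0 (subspace_span _))].
  by rewrite -cE /=; apply: big1 => j _; rewrite (iu c) ?scale0r // cE.
- by move=> j; case: (vP j).
- by move=> j; case: (vP j).
apply/seteqP; split=> [x Ux|_ [_ [a Sa [b' Sb <-]] [_ [c _ <-] <-]]]; last first.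
  apply: subD => //; first by apply: subD => //; [exact: SU2 | exact: SU3].
  by apply: sub_comb => // j; case: (vP j).
have : van_comp Comp1 V'' (ext_compl Comp1 x) by rewrite -U1; exists x.
rewrite VE => -[_ [a + [b' + <-]] [_ [c _ <-] xE]].
rewrite -from_left_image -from_right_image => -[q Sq qa] [p' Sp pb].
pose y := p' + q + \sum_j c j *: v j.
have Uy : U y.
  apply: subD => //; first by apply: subD => //; [exact: SU2 | exact: SU3].
  by apply: sub_comb => // j; case: (vP j).
have y1 : ext_compl Comp1 (x - y) = 0.
  have -> : ext_compl Comp1 (x - y) = ext_compl Comp1 x - ext_compl Comp1 y.
    exact: linearB.
  rewrite -xE !ext_complD ext_compl_comb -qa -pb.
  under [X in _ - (_ + X)]eq_bigr => j _ do rewrite (proj2 (vP j)).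
  by rewrite [X in _ - (X + _)]addrC subrr.
have /ker_from [r Sr [r' Sr' rE]] : (ext_comp Comp1 @` V'') (x - y).
  by rewrite U1'; split=> //; exact: subB.
exists ((r + p') + (r' + q)).
  exists (r + p'); first exact: (subD subspace_from_left).
  by exists (r' + q) => //; exact: (subD subspace_from_right).
exists (\sum_j c j *: v j); first by exists c.
by rewrite addrACA rE -addrA -/y subrK.
Qed.

End Step.

(** * Finiteness of a function field over a subfield k(h) *)

Section FiniteOver.
Variables (k : closedFieldType) (C : curve k).
Implicit Types (h : C).

Lemma scale_mul (a : k) (f : C) : a *: f = (a *: 1) * f.
Proof. by rewrite -scalerAl mul1r. Qed.

Lemma horner_alg_coefs (x : C) (p : {poly k}) n : (size p <= n)%N ->
  horner_alg x p = \sum_(j < n) p`_j *: x ^+ j.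
Proof.
move=> ltpn; rewrite [in LHS](_ : p = \poly_(j < n) p`_j); last first.
  apply/polyP => j; rewrite coef_poly; case: ltnP => // lenj.
  by rewrite nth_default // (leq_trans ltpn).
rewrite poly_def linear_sum; rewrite /=; apply: eq_bigr => j _.
by rewrite linearZ /= rmorphXn /= horner_algX mulr_algl.
Qed.

(** A dimension count. Let [Q] be a polynomial in [x] clearing the denominators
    of multiplication by [h] on the [n] generators [e] over [k(x)], and [B] a
    bound on the degrees that occur. After multiplication by [Q ^+ M] and a
    common denominator of the [y i], all [h ^+ a * y i] with [a <= M] lie in a
    space of dimension [n * (M * B)] up to a constant. Hence they are dependent
    for large [M] if there are more than [n * B] indices [i]. *)
Lemma finite_over h : exists N, forall (I : finType) (y : I -> C), (N < #|I|)%N ->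
  exists2 p : I -> {poly k}, (exists i, p i != 0) &
    \sum_i horner_alg h (p i) * y i = 0.
Proof.
have [x [x_tr [n [e e_span]]]] := curveP C.
pose Span D (w : C) := exists2 p : 'I_n -> {poly k},
  (forall s, (size (p s) <= D)%N) & w = \sum_s horner_alg x (p s) * e s.
have SpanM D (Q : {poly k}) w : Span D w -> Span (D + size Q)%N (horner_alg x Q * w).
  move=> [p pD ->]; exists (fun s => Q * p s) => [s|].
    by rewrite (leq_trans (size_polyMleq _ _)) // addnC; have := pD s; lia.
  by rewrite big_distrr; apply: eq_bigr => s _ /=; rewrite rmorphM mulrA.
have Span_sum (J : finType) D (w : J -> C) :
    (forall j, Span D (w j)) -> Span D (\sum_j w j).
  move=> wD; elim/big_ind: _ => // [|_ _ [p pD ->] [q qD ->]].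
    exists (fun=> 0) => [s|]; first by rewrite size_poly0.
    by rewrite big1 // => s _; rewrite rmorph0 mul0r.
  exists (fun s => p s + q s) => [s|].
    by rewrite (leq_trans (size_polyD _ _)) // geq_max pD qD.
  by rewrite -big_split; apply: eq_bigr => s _; rewrite linearD mulrDl.
have SpanW D D' w : (D <= D')%N -> Span D w -> Span D' w.
  by move=> le_D [p pD ->]; exists p => // s; exact: leq_trans (pD s) le_D.
have common (J : finType) (z : J -> C) : exists2 Q, Q != 0 :> {poly k} &
    exists D, forall j, Span D (horner_alg x Q * z j).
  have /choice [q /choice [p qp]] := fun j => e_span (z j).
  exists (\prod_j q j); first by apply/prodf_neq0 => j _; case: (qp j).
  pose t j s := (\prod_(i | i != j) q i) * p j s.
  exists (\max_(js : J * 'I_n) size (t js.1 js.2)) => j.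
  exists (t j) => [s|]; first exact: (leq_bigmax (j, s)).
  rewrite (bigD1 j) //= rmorphM mulrAC; case: (qp j) => _ ->.
  rewrite mulrC big_distrr; apply: eq_bigr => s _ /=.
  by rewrite mulrA rmorphM.
have [Q Q0 [D QD]] := common _ (fun s => h * e s).
pose B := (D + size Q)%N.
exists (n * B)%N => I y ltN.
have [Y Y0 [D' YD]] := common _ y.
have stepQ m w : Span m w -> Span (m + B)%N (horner_alg x Q * w).
  by move=> /(SpanM _ Q); apply: SpanW; rewrite /B; lia.
have stepQh m w : Span m w -> Span (m + B)%N (horner_alg x Q * (h * w)).
  move=> [p pm ->]; rewrite !big_distrr; apply: Span_sum => s /=.
  have -> : horner_alg x Q * (h * (horner_alg x (p s) * e s)) =
            horner_alg x (p s) * (horner_alg x Q * (h * e s)) by ring.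
  by apply: SpanW (SpanM _ (p s) _ (QD s)); rewrite /B; have := pm s; lia.
have key M a i : (a <= M)%N ->
    Span (D' + M * B)%N (horner_alg x (Q ^+ M * Y) * (h ^+ a * y i)).
  elim: M a => [|M IH] [|a] // leaM.
  - by rewrite expr0 !mul1r addn0; exact: YD.
  - have := stepQ _ _ (IH 0%N (leq0n _)).
    rewrite -addnA -mulSnr; congr Span; rewrite !rmorphM !rmorphXn /= exprS; ring.
  have := stepQh _ _ (IH a leaM).
  rewrite -addnA -mulSnr; congr Span; rewrite !rmorphM !rmorphXn /= !exprS; ring.
pose M := (n * D')%N.
have [||c [[i0 a0] ca0] cE] := @lin_dep_card k C ('I_(D' + M * B) * 'I_n)%type
  (I * 'I_M.+1)%type (fun j => x ^+ j.1 * e j.2)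
  (fun i => horner_alg x (Q ^+ M * Y) * (h ^+ i.2 * y i.1)).
- move=> [i a]; have [|p pD ->] := key M a i; first by case: a.
  exists (fun j : 'I_(D' + M * B) * 'I_n => (p j.2)`_j.1).
  rewrite -(pair_bigA _ (fun (j : 'I__) s => (p s)`_j *: (x ^+ j * e s))) exchange_big /=.
  apply: eq_bigr => s _; rewrite (horner_alg_coefs _ (pD s)) mulr_suml.
  by apply: eq_bigr => j _; rewrite -scalerAl.
- by rewrite !card_prod !card_ord /M; nia.
have {}cE : \sum_i horner_alg h (\poly_(a < M.+1) c (i, inord a)) * y i = 0.
  apply: (mulfI (x_tr _ (mulf_neq0 (expf_neq0 M Q0) Y0))).
  rewrite mulr0 -[RHS]cE; transitivity (\sum_i \sum_(a < M.+1) c (i, a) *: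
      (horner_alg x (Q ^+ M * Y) * (h ^+ a * y i))); last first.
    by rewrite pair_bigA; apply: eq_bigr => -[].
  rewrite mulr_sumr.
  apply: eq_bigr => i _.
  rewrite (horner_alg_coefs _ (size_poly _ _)) mulr_suml big_distrr /=.
  apply: eq_bigr => a _; rewrite coef_poly ltn_ord inord_val.
  by rewrite -!scalerAl -scalerAr.
exists (fun i => \poly_(a < M.+1) c (i, inord a)) => //.
exists i0; apply: contraNneq ca0 => /polyP /(_ a0).
by rewrite coef_poly ltn_ord inord_val coef0 => ->.
Qed.

(** Dividing a relation by a power of [h] makes some coefficient nonzero at
    [0]. *)
Lemma primitive_relation h (I : finType) (y : I -> C) (p : I -> {poly k}) :
    h != 0 -> (exists i, p i != 0) -> \sum_i horner_alg h (p i) * y i = 0 ->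
  exists (c : I -> k) (q : I -> {poly k}), (exists i, c i != 0) /\
    \sum_i c i *: y i = h * \sum_i horner_alg h (q i) * y i.
Proof.
move=> h0; have [n] := ubnP (\sum_i size (p i)); elim: n p => // n IH p.
move=> le_n [i0 pi0] pE.
have split_p i : exists q, p i = (p i).[0]%:P + q * 'X.
  have /factor_theorem [q qE] : root (p i - (p i).[0]%:P) 0.
    by rewrite /root !hornerE subrr.
  by exists q; rewrite -['X]subr0 -qE addrC subrK.
have {split_p} /choice [q qE] := split_p.
have hpE i : horner_alg h (p i) * y i =
    (p i).[0] *: y i + h * (horner_alg h (q i) * y i).
  rewrite {1}qE linearD /= rmorphM /= horner_algX horner_algC mulrDl.
  by rewrite mulr_algl; ring.
have sumE : \sum_i (p i).[0] *: y i + h * \sum_i horner_alg h (q i) * y i = 0.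
  by rewrite big_distrr -big_split -[RHS]pE; apply: eq_bigr => i _ /=; rewrite hpE.
have [[i ci]|allc] := pselect (exists i, (p i).[0] != 0).
  exists (fun i => (p i).[0]), (fun i => - q i); split; first by exists i.
  move/eqP: sumE; rewrite addr_eq0 => /eqP ->; rewrite -mulrN -sumrN.
  by congr (_ * _); apply: eq_bigr => j _; rewrite linearN mulNr.
have c0 i : (p i).[0] = 0 by apply: contra_notP allc => /eqP; exists i.
apply: (IH q).
- rewrite -ltnS (leq_trans _ le_n) // ltnS (bigD1 i0) // [ltnRHS](bigD1 i0) //=.
  have size_q i : (size (q i) <= size (p i))%N.
    rewrite qE c0 add0r; have [->|q0] := eqVneq (q i) 0; first by rewrite size_poly0.
    by rewrite size_mulX.
  rewrite -addSn leq_add //; last by apply: leq_sum => i _.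
  move: pi0; rewrite qE c0 add0r mulf_eq0 negb_or => /andP [q0 _].
  by rewrite size_mulX.
- by exists i0; move: pi0; rewrite qE c0 add0r mulf_eq0 negb_or => /andP [].
- move: sumE; rewrite big1 ?add0r => [/eqP|i _]; last by rewrite c0 scale0r.
  by rewrite mulf_eq0 (negbTE h0) => /eqP.
Qed.

(** The form in which finiteness is used: at a point where [h] vanishes, the
    right-hand side is negligible. *)
Lemma finite_over0 h : h != 0 ->
  exists N, forall (I : finType) (y : I -> C), (N < #|I|)%N ->
    exists (c : I -> k) (q : I -> {poly k}), (exists i, c i != 0) /\
      \sum_i c i *: y i = h * \sum_i horner_alg h (q i) * y i.
Proof.
move=> h0; have [N NP] := finite_over h; exists N => I y ltN.
have [p p0 pE] := NP I y ltN; exact: (primitive_relation h0 p0 pE).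
Qed.
End FiniteOver.

(** * Valuations *)

Section Valuation.
Variables (k : closedFieldType) (C : curve k) (P : point C).
Implicit Types (f g h : C) (m n : int).

Lemma ordZ (a : k) f : a != 0 -> ord P (a *: f) = ord P f.
Proof.
move=> a0; have [->|f0] := eqVneq f 0; first by rewrite scaler0.
by rewrite scale_mul ordM ?ordC ?add0r ?scaler_eq0 ?negb_or ?a0 ?oner_eq0.
Qed.

Lemma ord_1 : ord P 1 = 0.
Proof. by have := ordC P (oner_neq0 k); rewrite scale1r. Qed.

Lemma ordV f : f != 0 -> ord P f^-1 = - ord P f.
Proof.
move=> f0; apply/eqP; rewrite -addr_eq0 -ordM ?invr_eq0 //.
by rewrite mulVf // ord_1.
Qed.

Lemma ordN f : ord P (- f) = ord P f.
Proof. by rewrite -scaleN1r ordZ // oppr_eq0 oner_eq0. Qed.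

Lemma ord_geE n f : f != 0 -> ord_ge P n f <-> n <= ord P f.
Proof. by move=> f0; split=> [[/eqP|]//|]; [rewrite (negbTE f0) | right]. Qed.

Lemma ord_geW m n f : m <= n -> ord_ge P n f -> ord_ge P m f.
Proof. by move=> le_mn [->|le_nf]; [left | right; exact: le_trans le_nf]. Qed.

Lemma ord_geZ n (a : k) f : ord_ge P n f -> ord_ge P n (a *: f).
Proof.
have [->|a0] := eqVneq a 0; first by rewrite scale0r; left.
by move=> [->|le_nf]; [rewrite scaler0; left | right; rewrite ordZ].
Qed.

Lemma ord_geN n f : ord_ge P n f -> ord_ge P n (- f).
Proof. by rewrite -scaleN1r; exact: ord_geZ. Qed.

Lemma ord_geD n f g : ord_ge P n f -> ord_ge P n g -> ord_ge P n (f + g).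
Proof.
have [->|f0] := eqVneq f 0; first by rewrite add0r.
have [->|g0] := eqVneq g 0; first by rewrite addr0.
have [->|fg0] := eqVneq (f + g) 0; first by left.
move=> /(ord_geE _ f0) nf /(ord_geE _ g0) ng; right.
by apply: le_trans (ordD P f0 g0 fg0); rewrite le_min nf.
Qed.

Lemma ord_geB n f g : ord_ge P n f -> ord_ge P n g -> ord_ge P n (f - g).
Proof. by move=> nf /ord_geN; exact: ord_geD. Qed.

Lemma ord_ge_sum n (I : finType) (Q : pred I) (v : I -> C) :
  (forall i, Q i -> ord_ge P n (v i)) -> ord_ge P n (\sum_(i | Q i) v i).
Proof. by move=> nv; elim/big_ind: _ => //; [left | exact: ord_geD]. Qed.

Lemma ord_geM m n f g : ord_ge P m f -> ord_ge P n g -> ord_ge P (m + n) (f * g).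
Proof.
have [->|f0] := eqVneq f 0; first by rewrite mul0r; left.
have [->|g0] := eqVneq g 0; first by rewrite mulr0; left.
by move=> /(ord_geE _ f0) mf /(ord_geE _ g0) ng; right; rewrite ordM // lerD.
Qed.

Lemma ord_ge_1 : ord_ge P 0 1.
Proof. by right; rewrite ord_1. Qed.

Lemma ord_geX m f i : ord_ge P m f -> ord_ge P (m *+ i) (f ^+ i).
Proof.
move=> mf; elim: i => [|i IH]; first exact: ord_ge_1.
by rewrite exprS mulrS; exact: ord_geM.
Qed.

Lemma ord_ge_horner h (p : {poly k}) : ord_ge P 0 h -> ord_ge P 0 (horner_alg h p).
Proof.
move=> h0; rewrite (horner_alg_coefs _ (leqnn _)); apply: ord_ge_sum => i _.
by apply: ord_geZ; have := ord_geX i h0; rewrite mul0rn.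
Qed.

Lemma ord_ge_scale n (c : k) f : f != 0 -> ord P f < n ->
  ord_ge P n (c *: f) -> c = 0.
Proof.
move=> f0 lt_fn; have [//|c0] := eqVneq c 0; rewrite ord_geE; last first.
  by rewrite scaler_eq0 negb_or c0.
by rewrite ordZ // leNgt lt_fn.
Qed.

(** The residue field is [k]: a relation over [k[h]], with [h] in the maximal
    ideal, makes the residue of [f] algebraic over the algebraically closed
    field [k]. *)
Lemma residue f : ord_ge P 0 f -> exists c : k, ord_ge P 1 (f - c *: 1).
Proof.
move=> f0; have [t t0 ordt] := ord_surj P.
have [N /(_ 'I_N.+1 (fun i => f ^+ i))] := finite_over0 t0.
rewrite card_ord ltnSn => /(_ isT) [c [q [[i0 ci0] cE]]].
pose p := \poly_(i < N.+1) c (inord i).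
have p0 : p != 0.
  apply: contraNneq ci0 => /polyP /(_ i0).
  by rewrite coef_poly ltn_ord inord_val coef0 => ->.
have : ord_ge P 1 (horner_alg f p).
  rewrite (horner_alg_coefs _ (size_poly _ _)).
  rewrite (eq_bigr (fun i : 'I__ => c i *: f ^+ i)); last first.
    by move=> i _; rewrite coef_poly ltn_ord inord_val.
  rewrite cE -[1]addr0; apply: ord_geM; first by right; rewrite ordt.
  apply: ord_ge_sum => i _; rewrite -[0]addr0; apply: ord_geM.
    by apply: ord_ge_horner; right; rewrite ordt.
  by have := ord_geX i f0; rewrite mul0rn.
have [rs ->] := closed_field_poly_normal p.
have lc0 : lead_coef p != 0 by rewrite lead_coef_eq0.
move: (lead_coef p) lc0 => a a0.
rewrite linearZ /= mulr_algl => /(ord_geZ a^-1).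
rewrite scalerA mulVf // scale1r; elim: rs => [|z rs IH].
  rewrite big_nil rmorph1 ord_geE ?oner_eq0 // ord_1 //.
rewrite big_cons rmorphM rmorphB /= horner_algX horner_algC => fg1.
apply: contrapT => nofc; have /IH // : ord_ge P 1
    (horner_alg f (\prod_(j <- rs) ('X - j%:P))).
have fz0 : f - z%:A != 0.
  by apply: contra_notN nofc => /eqP fz; exists z; rewrite fz; left.
have fz1 : ord P (f - z%:A) = 0.
  have : ord_ge P 0 (f - z%:A) by apply: ord_geB => //; apply: ord_geZ; exact: ord_ge_1.
  rewrite ord_geE // le_eqVlt => /orP [/eqP <- //|fz1].
  by case: nofc; exists z; right.
move: fg1; set g := horner_alg f _.
have [->|g0] := eqVneq g 0; first by left.
by rewrite !ord_geE ?mulf_neq0 // ordM // fz1 add0r.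
Qed.

End Valuation.

Section Points.
Variables (k : closedFieldType) (C : curve k).
Implicit Types (P Q : point C) (f g h : C).

Lemma point_eq P Q : ord P =1 ord Q -> P = Q.
Proof.
case: P Q => [o o0 oM oD oC oS] [o' o0' oM' oD' oC' oS'] /funext /= oo'.
by subst o'; congr Point; exact: Prop_irrelevance.
Qed.

(** If every unit at [P] is a unit at [Q], then [ord Q] is a multiple of
    [ord P], hence [ord P] itself up to sign, and the sign is that of [ord P]
    because [1 + f] is a unit at [P] for [f] in the maximal ideal. *)
Lemma point_sep P Q : P <> Q -> exists2 z : C, z != 0 & ord P z = 0 /\ 0 < ord Q z.
Proof.
move=> PQ; apply: contrapT => noz; apply: PQ; apply: point_eq.
have unitQ z : z != 0 -> ord P z = 0 -> ord Q z = 0.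
  move=> z0 Pz; apply/eqP; rewrite eq_le !leNgt; apply/andP; split.
    by apply/negP => Qz; apply: noz; exists z.
  apply/negP => Qz; apply: noz; exists z^-1; rewrite ?invr_eq0 //.
  by rewrite !ordV // Pz oppr0 oppr_gt0.
have [t t0 Pt] := ord_surj P; have [s s0 Qs] := ord_surj Q.
have tX (n : nat) : ord P (t ^+ n) = n /\ ord Q (t ^+ n) = ord Q t *+ n.
  elim: n => [|n [IHP IHQ]]; first by rewrite !expr0 !ord_1.
  by rewrite exprS !ordM ?expf_neq0 // IHP IHQ Pt mulrS -intS.
have QE f : f != 0 -> ord Q f = ord Q t * ord P f.
  move=> f0; case E : (ord P f) => [n|n].
    have : ord Q (f / t ^+ n) = 0.
      apply: unitQ; first by rewrite mulf_neq0 ?invr_eq0 ?expf_neq0.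
      by rewrite ordM ?ordV ?invr_eq0 ?expf_neq0 // (tX n).1 E subrr.
    rewrite ordM ?ordV ?invr_eq0 ?expf_neq0 // (tX n).2 => /eqP.
    by rewrite subr_eq0 => /eqP ->; rewrite -mulr_natr natz.
  have : ord Q (f * t ^+ n.+1) = 0.
    apply: unitQ; first by rewrite mulf_neq0 ?expf_neq0.
    by rewrite ordM ?expf_neq0 // (tX n.+1).1 E NegzE addNr.
  rewrite ordM ?expf_neq0 // (tX n.+1).2 => /eqP.
  by rewrite addr_eq0 => /eqP ->; rewrite NegzE mulrN -mulr_natr natz.
have := QE s s0; rewrite Qs => QtE.
have Qt1 : ord Q t = 1 \/ ord Q t = -1.
  move/(congr1 absz)/esym/eqP: QtE; rewrite abszM muln_eq1 => /andP [/eqP Qt1 _].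
  by move: Qt1; lia.
move=> f; have [->|f0] := eqVneq f 0; first by rewrite !Defs.ord0.
case: Qt1 => Qt1; first by rewrite QE // Qt1 mul1r.
have t1 : 1 + t != 0.
  apply/eqP => /eqP; rewrite addr_eq0 => /eqP E.
  by have := ord_1 P; rewrite E ordN Pt.
have : ord P (1 + t) = 0.
  have : ord_ge P 0 (1 + t) by apply: ord_geD; right; rewrite ?ord_1 ?Pt.
  rewrite ord_geE // le_eqVlt => /orP [/eqP <- //|lt0].
  have : ord_ge P 1 (1 + t - t) by apply: ord_geB; right; rewrite ?Pt.
  by rewrite addrK ord_geE ?oner_eq0 // ord_1.
move=> /(unitQ _ t1) Q1t.
have : ord_ge Q 0 (1 + t - 1) by apply: ord_geB; right; rewrite ?ord_1 ?Q1t.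
by rewrite addrAC subrr add0r ord_geE // Qt1.
Qed.

End Points.

(** * Existence of points *)

Section PlaceExistence.
Variables (k : closedFieldType) (C : curve k) (h : C).
Hypothesis h_tr : forall p : {poly k}, p != 0 -> horner_alg h p != 0.

Let h0 : h != 0.
Proof. by have := h_tr (negbT (polyX_eq0 k)); rewrite horner_algX. Qed.

(** The subrings containing [k[h]] in which [h] is not invertible. A maximal
    one is a valuation ring, whose valuation is positive on [h]. *)
Definition proper_subring (S : set C) :=
  [/\ forall p, S (horner_alg h p), forall x y, S x -> S y -> S (x - y),
      forall x y, S x -> S y -> S (x * y) & ~ S h^-1].

Lemma maximal_proper_subring : exists A, proper_subring A /\
  forall B, A `<=` B -> proper_subring B -> B `<=` A.
Proof.
pose P (S : set C) := S = set0 \/ proper_subring S.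
have PS0 : proper_subring (range (horner_alg h)).
  split=> [p|_ _ [p _ <-] [q _ <-]|_ _ [p _ <-] [q _ <-]|[p _ pE]].
  - by exists p.
  - by exists (p - q); rewrite // rmorphB.
  - by exists (p * q); rewrite // rmorphM.
  have p1 : 'X * p - 1 != 0.
    apply/eqP => /(congr1 (fun q => q.[0])); rewrite !hornerE => /eqP.
    by rewrite ?mul0r ?sub0r oppr_eq0 oner_eq0.
  have := h_tr p1; rewrite rmorphB rmorphM /= rmorph1 horner_algX pE.
  by rewrite mulfV // subrr eqxx.
have [F FP Ftot|A [PA Amax]] := @Zorn_bigcup C P.
  have [[A0 FA0 gA0]|noA] := pselect (exists2 A, F A & proper_subring A); last first.
    left; apply/seteqP; split=> // x [A FA Ax]; case: (FP A FA) => [A0|gA].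
      by rewrite A0 in Ax.
    by case: noA; exists A.
  have gF A x : F A -> A x -> proper_subring A.
    by move=> FA Ax; case: (FP A FA) => // A_0; rewrite A_0 in Ax.
  have two x y : (\bigcup_(A in F) A) x -> (\bigcup_(A in F) A) y ->
      exists A, [/\ F A, A x & A y].
    move=> [A FA Ax] [B FB By]; case: (Ftot A B FA FB) => sub.
      by exists B; split=> //; exact: sub.
    by exists A; split=> //; exact: sub.
  right; split=> [p|x y Fx Fy|x y Fx Fy|[A FA Ah]].
  - by exists A0 => //; case: gA0.
  - have [A [FA Ax Ay]] := two x y Fx Fy; exists A => //.
    by have [_ AB _ _] := gF A x FA Ax; exact: AB.
  - have [A [FA Ax Ay]] := two x y Fx Fy; exists A => //.
    by have [_ _ AM _] := gF A x FA Ax; exact: AM.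
  - by have [_ _ _] := gF A _ FA Ah.
have gA : proper_subring A.
  case: PA => // A_0; exfalso; apply: (Amax (range (horner_alg h))); last by right.
  by rewrite A_0; split=> [//|/(_ _ (imageP _ (I : setT 0)))].
exists A; split=> // B AB gB; apply: contrapT => nBA.
by apply: (Amax B); [split | right].
Qed.

Section ValuationRing.
Variable A : set C.
Hypothesis Aring : proper_subring A.
Hypothesis Amax : forall B, A `<=` B -> proper_subring B -> B `<=` A.

Let Ahorner p : A (horner_alg h p).
Proof. by case: Aring. Qed.
Let AB x y : A x -> A y -> A (x - y).
Proof. by case: Aring => _ + _ _; apply. Qed.
Let AM x y : A x -> A y -> A (x * y).
Proof. by case: Aring => _ _ + _; apply. Qed.
Let AhV : ~ A h^-1.
Proof. by case: Aring. Qed.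
Let AC (c : k) : A c%:A.
Proof. by have := Ahorner c%:P; rewrite horner_algC. Qed.
Let A0 : A 0.
Proof. by have := AC 0; rewrite scale0r. Qed.
Let A1 : A 1.
Proof. by have := AC 1; rewrite scale1r. Qed.
Let AN x : A x -> A (- x).
Proof. by move=> Ax; rewrite -sub0r; exact: AB. Qed.
Let AD x y : A x -> A y -> A (x + y).
Proof. by move=> Ax Ay; rewrite -[y]opprK; apply: AB => //; exact: AN. Qed.
Let Ah : A h.
Proof. by have := Ahorner 'X; rewrite horner_algX. Qed.
Let Asum (I : Type) (r : seq I) (F : I -> C) :
  (forall i, A (F i)) -> A (\sum_(i <- r) F i).
Proof. by move=> AF; elim/big_ind: _ => // x y; exact: AD. Qed.
Let AX x n : A x -> A (x ^+ n).
Proof. by move=> Ax; elim: n => [|n IH]; rewrite ?expr0 ?exprS //; exact: AM. Qed.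

Let I x := exists2 y, A y & x = h * y.

Let ID x y : I x -> I y -> I (x + y).
Proof. by move=> [a Aa ->] [b Ab ->]; exists (a + b); rewrite ?mulrDr //; exact: AD. Qed.
Let IM a x : A a -> I x -> I (a * x).
Proof. by move=> Aa [b Ab ->]; exists (a * b); [exact: AM | rewrite mulrCA]. Qed.
Let IA x : I x -> A x.
Proof. by move=> [a Aa ->]; exact: AM. Qed.
Let I0 : I 0.
Proof. by exists 0; rewrite ?mulr0. Qed.

(** By maximality, adjoining [z] makes [h] invertible. *)
Let adjoin z : z \notin [set x | A x] ->
  exists p : {poly C}, (forall i, I p`_i) /\ p.[z] = 1.
Proof.
move=> /negP nAz; pose B := [set x | exists p : {poly C}, (forall i, A p`_i) /\ x = p.[z]].
have AsubB : A `<=` B.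
  move=> x Ax; exists x%:P; split; last by rewrite hornerC.
  by move=> i; rewrite coefC; case: eqP.
have [BhV|nBhV] := pselect (B h^-1).
  have [p [Ap hE]] := BhV; exists (h *: p); split=> [i|].
    by exists p`_i; rewrite ?coefZ.
  by rewrite hornerZ -hE mulfV.
exfalso; apply: nAz; apply/mem_set; apply: (Amax AsubB).
  split=> // [p|x y [p [Ap ->]] [q [Aq ->]]|x y [p [Ap ->]] [q [Aq ->]]].
  - exact/AsubB/Ahorner.
  - exists (p - q); split=> [i|]; first by rewrite coefB; exact: AB.
    by rewrite hornerD hornerN.
  - exists (p * q); split=> [i|]; last by rewrite hornerM.
    by rewrite coefM; apply: Asum => j; exact: AM.
exists 'X; split; last by rewrite hornerX.
by move=> i; rewrite coefX; case: eqP.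
Qed.

(** Of two relations expressing [1] by positive powers of [z] and of [z^-1]
    with coefficients in [h A], the longer can be shortened by the other. *)
Let no_relations n (z : C) (p q : {poly C}) : z != 0 ->
  (forall i, I p`_i) -> (forall i, I q`_i) -> p.[z] = 1 -> q.[z^-1] = 1 ->
  (size p + size q <= n)%N -> False.
Proof.
elim: n z p q => [|n IH] z p q z0 Ip Iq pz qz.
  rewrite leqn0 addn_eq0 size_poly_eq0 => /andP [/eqP p0 _].
  by move/eqP: pz; rewrite p0 horner0 eq_sym oner_eq0.
wlog le_qp : z p q z0 Ip Iq pz qz / (size q <= size p)%N.
  move=> W le_n; case: (leqP (size q) (size p)) => [|/ltnW] le_pq.
    exact: (W z p q).
  apply: (W z^-1 q p) => //; rewrite ?invr_eq0 ?invrK //.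
  by rewrite addnC.
move=> le_n; case Ep: (size p) => [|m].
  move/eqP: pz; move/eqP: Ep; rewrite size_poly_eq0 => /eqP ->.
  by rewrite horner0 eq_sym oner_eq0.
case: m Ep => [|m] Ep.
  move: pz; rewrite [p]size1_polyC ?Ep // hornerC => p1.
  have [a Aa] := Ip 0%N; rewrite p1 => ha; apply: AhV.
  by rewrite (_ : h^-1 = a) //; apply: (mulfI h0); rewrite -ha mulfV.
pose lead := p`_m.+1.
(* Multiply the relation for [z^-1] by [lead * z ^+ m.+1], substitute it for the
   leading term of [1 - q`_0] times the relation for [z]. *)
pose p' := q`_0 *: 1 + (1 - q`_0) *: (\poly_(i < m.+1) p`_i)
  + lead *: (\poly_(i < m.+1) q`_(m.+1 - i)) : {poly C}.
have size_p' : (size p' <= m.+1)%N.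
  rewrite /p' (leq_trans (size_polyD _ _)) // geq_max; apply/andP; split.
    rewrite (leq_trans (size_polyD _ _)) // geq_max; apply/andP; split.
      by rewrite (leq_trans (size_scale_leq _ _)) // size_poly1.
    by rewrite (leq_trans (size_scale_leq _ _)) // size_poly.
  by rewrite (leq_trans (size_scale_leq _ _)) // size_poly.
apply: (IH z p' q) => //; last first.
- by rewrite -ltnS (leq_trans _ le_n) // -addSn leq_add2r Ep.
- rewrite /p' !hornerE.
  have qE : 1 - q`_0 = \sum_(i < m.+1) q`_i.+1 * z^-1 ^+ i.+1.
    rewrite -{1}qz (horner_coef_wide _ (n := m.+2)) ?big_ord_recl; last first.
      by rewrite -Ep.
    by rewrite expr0 mulr1 addrAC subrr add0r.
  have pE : 1 = \sum_(i < m.+1) p`_i * z ^+ i + lead * z ^+ m.+1.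
    by rewrite -{1}pz horner_coef Ep big_ord_recr.
  rewrite ![(\poly_(_ < _) _).[z]]horner_poly.
  have -> : \sum_(i < m.+1) q`_(m.+1 - i) * z ^+ i = z ^+ m.+1 * (1 - q`_0).
    rewrite qE mulr_sumr (reindex_inj rev_ord_inj) /=; apply: eq_bigr => i _.
    have lt_i := ltn_ord i; rewrite subKn // mulrCA; congr (_ * _).
    apply: (mulIf (expf_neq0 i.+1 z0)); rewrite -exprD subnK // -mulrA exprVn.
    by rewrite mulVf ?expf_neq0 // mulr1.
  rewrite mulrA [lead * _ * _]mulrC -addrA -mulrDr -pE.
  by rewrite mulr1 addrC subrK.
- move=> i; rewrite /p' !coefD !coefZ !coef_poly coef1.
  have A1q : A (1 - q`_0) by apply: AB => //; exact: IA.
  apply: ID; [apply: ID|].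
  + by case: eqP => _ /=; rewrite ?mulr1 ?mulr0.
  + by apply: IM => //; case: ifP.
  + by apply: IM; [exact: IA (Ip _) | case: ifP].
Qed.

Lemma valuation_ring z : A z \/ A z^-1.
Proof.
have [->|z0] := eqVneq z 0; first by left.
case: (boolP (z \in [set x | A x])) => [/set_mem //|/adjoin [p [Ip pz]]]; first by left.
case: (boolP (z^-1 \in [set x | A x])) => [/set_mem //|/adjoin [q [Iq qz]]]; first by right.
by case: (no_relations z0 Ip Iq pz qz (leqnn _)).
Qed.


Let M z := z = 0 \/ ~ A z^-1.

Let MA z : M z -> A z.
Proof. by case=> [->//|nAz]; case: (valuation_ring z). Qed.

Let MM a x : A a -> M x -> M (a * x).
Proof.
move=> Aa Mx; have [->|ax0] := eqVneq (a * x) 0; first by left.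
move: ax0; rewrite mulf_eq0 negb_or => /andP [a0 x0].
case: Mx => [xE|nAx]; first by rewrite xE eqxx in x0.
right=> Aax; apply: nAx.
have -> : x^-1 = a * (a * x)^-1 by rewrite invfM mulVKf.
exact: AM.
Qed.

Let MD x y : M x -> M y -> M (x + y).
Proof.
wlog: x y / A (x / y) => [W|Axy] Mx My.
  have [|/[!invf_div]] := valuation_ring (x / y); first by move/W; apply.
  by move=> /W Wyx; rewrite addrC; exact: Wyx.
have [y0|y0] := eqVneq y 0; first by rewrite y0 addr0.
rewrite (_ : x + y = (x / y + 1) * y); last by rewrite mulrDl mul1r divfK.
by apply: MM => //; exact: AD.
Qed.

Let invC (c : k) : (c%:A : C)^-1 = c^-1%:A.
Proof. by rewrite -!in_algE fmorphV. Qed.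

Let MC (c : k) : M c%:A -> c = 0.
Proof.
have [//|c0] := eqVneq c 0; case=> [/eqP|[]].
  by rewrite scaler_eq0 oner_eq0 (negbTE c0).
by rewrite invC.
Qed.

Let Mprod s : (forall x, x \in s -> M x) -> (0 < size s)%N -> M (\prod_(x <- s) x).
Proof.
elim: s => // x s IH Ms _; rewrite big_cons mulrC.
apply: MM; last by apply: Ms; rewrite mem_head.
case: s IH Ms => [|y s] IH Ms; first by rewrite big_nil.
by apply: MA; apply: IH => // z zs; apply: Ms; rewrite inE zs orbT.
Qed.

Let Aprod s : (forall x, x \in s -> M x) -> A (\prod_(x <- s) x).
Proof.
by case: s => [|x s] Ms; [rewrite big_nil | apply: MA; exact: Mprod].
Qed.

(** The partial products of a factorization of [z] into non-units are
    linearly independent over [k(z)], so their number is bounded. *)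
Let factor_bound z : z != 0 -> exists N, forall s,
  (forall x, x \in s -> M x) -> \prod_(x <- s) x = z -> (size s <= N)%N.
Proof.
move=> z0; have [N NP] := finite_over0 z0; exists N => s Ms sz.
rewrite leqNgt; apply/negP => ltNs.
have Mz : M z by rewrite -sz; apply: Mprod => //; exact: leq_ltn_trans ltNs.
pose x i := \prod_(y <- drop i s) y.
have xE i j : (i <= j)%N -> x i = (\prod_(y <- take (j - i) (drop i s)) y) * x j.
  by move=> le_ij; rewrite /x -big_cat -{2}(subnK le_ij) -drop_drop cat_take_drop.
have x0 i : x i != 0.
  have : x 0%N != 0 by rewrite /x drop0 sz.
  by rewrite (xE 0%N i) // mulf_eq0 negb_or => /andP [].
have sub_s i j y : y \in take i (drop j s) -> M y.
  by move=> /mem_take /mem_drop; exact: Ms.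
have Ax i j : (i <= j)%N -> A (x i / x j).
  move=> le_ij; rewrite (xE i j le_ij) mulfK //; apply: Aprod => y; exact: sub_s.
have Mx i j : (i < j)%N -> (j <= size s)%N -> M (x i / x j).
  move=> lt_ij le_js; rewrite (xE i j (ltnW lt_ij)) mulfK //.
  apply: Mprod => [y|]; first exact: sub_s.
  by rewrite size_take size_drop; case: ifP => _; rewrite subn_gt0 // (leq_trans lt_ij).
have [|c [q [[i0 ci0] cE]]] := NP 'I_(size s) (fun i => x i).
  by rewrite card_ord.
have [j cj jmax] := @arg_maxnP _ i0 (fun i => c i != 0) (fun i : 'I_(size s) => i : nat) ci0.
move/negP: cj; apply; apply/eqP/MC.
have -> : (c j)%:A = (z / x j) * (\sum_i horner_alg z (q i) * x i)
    - \sum_(i | i != j) c i *: (x i / x j).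
  apply: (mulIf (x0 j)); rewrite mulrBl mulrAC divfK // -cE (bigD1 j) //=.
  rewrite -scalerAl mul1r mulr_suml [X in _ - X](eq_bigr (fun i => c i *: x i)) ?addrK //.
  by move=> i _; rewrite -scalerAl divfK.
have Az : A z by exact: MA.
apply: MD.
  apply: MM; first by rewrite -sz -[s in \prod_(_ <- s) _]drop0; exact: Ax.
  elim/big_ind: _ => [|u v|i _]; [by left | exact: MD |].
  rewrite (horner_alg_coefs _ (leqnn _)); apply: MM.
    by apply: Asum => l; rewrite -mulr_algl; apply: AM => //; exact: AX.
  by apply: Mprod => [y /mem_drop /Ms //|]; rewrite size_drop subn_gt0.
rewrite -mulN1r; apply: MM; first exact: AN.
elim/big_ind: _ => [|u v|i nij]; [by left | exact: MD |].
rewrite -mulr_algl; have [->|ci] := eqVneq (c i) 0.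
  by rewrite scale0r mul0r; left.
apply: MM => //; apply: Mx; last exact: ltnW.
have : (i <= j)%N := jmax _ ci.
by rewrite leq_eqVlt => /orP [/eqP /val_inj /eqP|//]; rewrite (negbTE nij).
Qed.

Let Mh : M h.
Proof. by right. Qed.

(** A first factor in a longest factorization of [h] into non-units: if it did
    not divide a non-unit [y], it could be factored as [y] times a non-unit. *)
Let uniformizer : exists t, [/\ t != 0, M t & forall y, M y -> A (y / t)].
Proof.
have [N NP] := factor_bound h0.
pose Q n := `[< exists s, [/\ forall x, x \in s -> M x, \prod_(x <- s) x = h & size s = n] >].
have Q1 : exists n, Q n.
  exists 1%N; apply/asboolP; exists [:: h]; split=> // [x|]; last by rewrite big_seq1.
  by rewrite inE => /eqP ->.
have QN n : Q n -> (n <= N)%N by move=> /asboolP [s [Ms sh <-]]; exact: NP.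
case: (ex_maxnP Q1 QN) => n /asboolP [s [Ms sh sn]] nmax.
case: s Ms sh sn => [|t s] Ms sh sn.
  by exfalso; apply: AhV; rewrite -sh big_nil invr1.
exists t; have t0 : t != 0.
  by apply: contraNneq h0 => t0; rewrite -sh big_cons t0 mul0r.
split=> // [|y My]; first by apply: Ms; rewrite mem_head.
apply: contrapT => nAy; have y0 : y != 0.
  by apply/eqP => y0; apply: nAy; rewrite y0 mul0r.
suff /nmax : Q n.+1 by rewrite ltnn.
apply/asboolP; exists [:: y, t / y & s]; split.
- move=> x; rewrite !inE => /or3P [/eqP ->//|/eqP ->|xs].
    by right; rewrite invf_div.
  by apply: Ms; rewrite inE xs orbT.
- by rewrite !big_cons mulrA [y * _]mulrC divfK // -sh big_cons.
- by rewrite -sn.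
Qed.

(** Splitting off factors [t] from a given element must end, by the bound on
    the number of non-unit factors; so every nonzero function is a power of [t]
    times a unit. *)
Lemma place_of_ring : exists P : point C, 0 < ord P h.
Proof.
have [t [t0 Mt tP]] := uniformizer.
pose U z := [/\ z != 0, A z & A z^-1].
have UM x y : U x -> U y -> U (x * y).
  by move=> [x0 Ax Ax'] [y0 Ay Ay']; split; rewrite ?mulf_neq0 ?invfM //; exact: AM.
have UV x : U x -> U x^-1.
  by move=> [x0 Ax Ax']; split; rewrite ?invrK ?invr_eq0.
have U1 : U 1 by split; rewrite ?invr1 ?oner_eq0.
have UC (c : k) : c != 0 -> U c%:A.
  move=> c0; split=> //; first by rewrite scaler_eq0 oner_eq0 orbF.
  by rewrite invC.
have notUM z : A z -> z != 0 -> ~ U z -> M z.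
  by move=> Az z0 nU; right => Az'; apply: nU.
have UnM z : U z -> ~ M z by move=> [z0 _ Az'] [/eqP|//]; rewrite (negbTE z0).
have tX_U (n : int) : U (t ^ n) -> n = 0.
  case: n => [[//|n]|n] Un.
    case: (UnM _ Un); rewrite -exprnP exprSr; apply: MM => //.
    by apply: AX; exact: MA.
  move/UV: Un; rewrite NegzE invr_expz opprK => Un.
  case: (UnM _ Un); rewrite -exprnP exprSr; apply: MM => //.
  by apply: AX; exact: MA.
have ordA z : A z -> z != 0 -> exists n : nat, U (z / t ^+ n).
  move=> Az z0; have [N NP] := factor_bound z0.
  elim: N z Az z0 NP => [|N IH] z Az z0 NP.
    exists 0%N; rewrite divr1; apply: contrapT => /(notUM z Az z0) Mz.
    have : (size [:: z] <= 0)%N; last by [].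
    by apply: NP; rewrite ?big_seq1 // => x; rewrite inE => /eqP ->.
  have [Uz|/(notUM z Az z0) Mz] := pselect (U z); first by exists 0%N; rewrite divr1.
  have [||s Ms sE|n] := IH (z / t).
  - exact: tP.
  - by rewrite mulf_neq0 ?invr_eq0.
  - rewrite -ltnS; apply: (NP (t :: s)).
      by move=> x; rewrite inE => /orP [/eqP ->|/Ms].
    by rewrite big_cons sE mulrC divfK.
  by exists n.+1; rewrite exprS invfM mulrA.
have ordex z : exists n : int, z != 0 -> U (z / t ^ n).
  have [->|z0] := eqVneq z 0; first by exists 0.
  have [Az|Az] := valuation_ring z.
    by have [n Un] := ordA z Az z0; exists n.
  have [|n Un] := ordA _ Az; first by rewrite invr_eq0.
  exists (- n%:Z) => _; move/UV: Un.
  by rewrite invfM !invrK invr_expz opprK.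
have {ordex} [o oP] := choice ordex.
have tn0 (n : int) : t ^ n != 0 by exact: expfz_neq0.
have o_uniq z n : z != 0 -> U (z / t ^ n) -> o z = n.
  move=> z0 Un; apply/eqP; rewrite -subr_eq0; apply/eqP/tX_U.
  rewrite (_ : t ^ _ = (z / t ^ n) / (z / t ^ o z)); last first.
    by rewrite expfzDr // -invr_expz; field; rewrite !tn0 z0.
  by apply: UM => //; apply: UV; exact: oP.
have oM x y : x != 0 -> y != 0 -> o (x * y) = o x + o y.
  move=> x0 y0; apply: o_uniq; first by rewrite mulf_neq0.
  rewrite (_ : _ / _ = (x / t ^ o x) * (y / t ^ o y)); first by apply: UM; exact: oP.
  by rewrite expfzDr //; field; rewrite !tn0.
have o_tX n : o (t ^ n) = n by apply: o_uniq => //; rewrite divff.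
have oU z : U z -> o z = 0.
  by move=> Uz; apply: o_uniq; [case: Uz | rewrite expr0z divr1].
have oA z : z != 0 -> A z <-> 0 <= o z.
  move=> z0; split=> [Az|oz].
    have [n Un] := ordA z Az z0.
    by rewrite (o_uniq z n%:Z z0 Un).
  have [_ Az _] := oP z z0; rewrite -[z](divfK (tn0 (o z))); apply: AM => //.
  by case: (o z) oz => // n _; apply: AX; exact: MA.
pose ordz z := if z == 0 then 0 else o z.
have ordzE z : z != 0 -> ordz z = o z by rewrite /ordz => /negbTE ->.
have ordz0 : ordz 0 = 0 by rewrite /ordz eqxx.
have ordzM x y : x != 0 -> y != 0 -> ordz (x * y) = ordz x + ordz y.
  by move=> x0 y0; rewrite !ordzE ?mulf_neq0 // oM.
have ordzD x y : x != 0 -> y != 0 -> x + y != 0 ->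
    Num.min (ordz x) (ordz y) <= ordz (x + y).
  wlog le_xy : x y / o x <= o y => [W|] x0 y0 xy0.
    have [|/ltW] := leP (o x) (o y) => le_xy; first exact: W.
    by rewrite minC addrC; apply: W => //; rewrite addrC.
  rewrite !ordzE // (min_idPl le_xy).
  have -> : x + y = t ^ o x * (x / t ^ o x + y / t ^ o x).
    by field; rewrite tn0.
  have xy0' : x / t ^ o x + y / t ^ o x != 0.
    by rewrite -mulrDl mulf_neq0 ?invr_eq0.
  rewrite oM // o_tX lerDl; apply/oA => //; apply: AD; first by case: (oP x x0).
  apply/oA; first by rewrite mulf_neq0 ?invr_eq0.
  by rewrite oM ?invr_eq0 // invr_expz o_tX subr_ge0.
have ordzC (a : k) : a != 0 -> ordz (a *: 1) = 0.
  by move=> /UC Ua; rewrite ordzE ?oU //; case: Ua.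
have ordz_surj : exists2 s : C, s != 0 & ordz s = 1.
  by exists t => //; rewrite ordzE // -[t]expr1z o_tX.
exists (Point ordz0 ordzM ordzD ordzC ordz_surj) => /=.
rewrite ordzE // lt_def (oA _ h0).1 // andbT; apply/eqP => oh.
case: (UnM _ _ Mh); have := oP h h0; by rewrite oh expr0z divr1.
Qed.

End ValuationRing.

Lemma place_exists : exists P : point C, 0 < ord P h.
Proof.
have [A [gA Amax]] := maximal_proper_subring.
exact: (place_of_ring gA Amax).
Qed.

End PlaceExistence.

(** * The degree of a divisor with a section *)

Section Degree.
Variables (k : closedFieldType) (C : curve k).
Implicit Types (P Q R : point C) (f g h z : C) (s : seq (point C)).

(** The inverse of a nonconstant function is transcendental over the
    algebraically closed field [k], so it vanishes at some point. *)
Lemma pole_exists f : (forall c : k, f <> c%:A) -> exists P : point C, ord P f < 0.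
Proof.
move=> f_nc; have f0 : f != 0.
  by apply/eqP => f0; apply: (f_nc 0); rewrite scale0r.
have [p p0|P Pf] := @place_exists k C f^-1; last first.
  by exists P; rewrite -oppr_gt0 -ordV.
apply/negP => /eqP; have [rs ->] := closed_field_poly_normal p.
move/eqP; rewrite linearZ /= mulr_algl scaler_eq0 lead_coef_eq0 (negbTE p0) /=.
rewrite rmorph_prod prodf_seq_eq0 => /hasP [z _ /=].
rewrite rmorphB /= horner_algX horner_algC subr_eq0 => /eqP fz.
by apply: (f_nc z^-1); rewrite -[f]invrK fz -!in_algE fmorphV.
Qed.

(** Having no pole, [f] is constant. *)
Lemma global_vanishing f P : (forall Q, ord_ge Q 0 f) -> ord_ge P 1 f -> f = 0.
Proof.
move=> f_reg f1; have [[c fE]|f_nc] := pselect (exists c : k, f = c%:A); last first.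
  have [|Q] := @pole_exists f; first by move=> c fE; apply: f_nc; exists c.
  have f0 : f != 0 by apply/eqP => f0; apply: f_nc; exists 0; rewrite scale0r.
  by rewrite ltNge ((ord_geE Q 0 f0).1 (f_reg Q)).
rewrite fE (@ord_ge_scale _ _ P 1 c 1) ?scale0r ?oner_eq0 ?ord_1 //.
by rewrite -fE.
Qed.

Lemma ord_add_lt P f g : f != 0 -> ord_ge P (ord P f + 1) g ->
  f + g != 0 /\ ord P (f + g) = ord P f.
Proof.
move=> f0 fg; have nfg : ~ ord_ge P (ord P f + 1) (f + g).
  move=> /ord_geB /(_ fg); rewrite addrK ord_geE //; lia.
have fg0 : f + g != 0 by apply/eqP => fg0; apply: nfg; rewrite fg0; left.
split=> //; have : ord_ge P (ord P f) (f + g).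
  by apply: ord_geD; [right | apply: ord_geW fg; lia].
by move: nfg; rewrite !ord_geE //; lia.
Qed.

(** Passing to [z / (1 + z)] or to [z / (1 + z + z ^+ 2)], whichever has a
    denominator that is a unit at [P], removes the poles of [z] and keeps its
    zeros. *)
Lemma remove_pole P R z : z != 0 -> ord P z = 0 ->
  exists z', [/\ z' != 0, ord P z' = 0, 0 <= ord R z' &
    forall Q, 0 < ord Q z -> 0 < ord Q z'].
Proof.
move=> z0 Pz; have [Rz|Rz] := leP 0 (ord R z); first by exists z.
have ord1z Q : 0 < ord Q z -> 1 + z != 0 /\ ord Q (1 + z) = 0.
  move=> Qz; have := @ord_add_lt Q 1 z; rewrite oner_eq0 ord_1; apply=> //.
  by right; lia.
have ord1z' Q : 0 < ord Q z -> 1 + z * (1 + z) != 0 /\ ord Q (1 + z * (1 + z)) = 0.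
  move=> Qz; have [z1 Qz1] := ord1z _ Qz.
  have := @ord_add_lt Q 1 (z * (1 + z)); rewrite oner_eq0 ord_1; apply=> //.
  by right; rewrite ordM //; lia.
have [z1 Rz1] : z + 1 != 0 /\ ord R (z + 1) = ord R z.
  by apply: ord_add_lt => //; right; rewrite ord_1; lia.
rewrite addrC in z1 Rz1.
have [z1' Rz1'] : z * (1 + z) + 1 != 0 /\ ord R (z * (1 + z) + 1) = ord R z + ord R z.
  have := @ord_add_lt R (z * (1 + z)) 1; rewrite ordM // Rz1; apply.
    by rewrite mulf_neq0.
  by right; rewrite ord_1; lia.
rewrite addrC in z1' Rz1'.
have [Pz1|Pz1] := eqVneq (ord P (1 + z)) 0.
  exists (z / (1 + z)); split.
  - by rewrite mulf_neq0 ?invr_eq0.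
  - by rewrite ordM ?ordV ?invr_eq0 // Pz Pz1.
  - by rewrite ordM ?ordV ?invr_eq0 // Rz1 subrr.
  - by move=> Q Qz; rewrite ordM ?ordV ?invr_eq0 // (ord1z _ Qz).2; lia.
have {}Pz1 : 0 < ord P (1 + z).
  have : ord_ge P 0 (1 + z) by apply: ord_geD; right; rewrite ?ord_1 ?Pz.
  by rewrite ord_geE //; lia.
exists (z / (1 + z * (1 + z))); split.
- by rewrite mulf_neq0 ?invr_eq0.
- have := @ord_add_lt P 1 (z * (1 + z)); rewrite oner_eq0 ord_1 => -[] //.
    by right; rewrite ordM //; lia.
  by move=> _ E; rewrite ordM ?ordV ?invr_eq0 // Pz E.
- by rewrite ordM ?ordV ?invr_eq0 // Rz1'; lia.
- by move=> Q Qz; rewrite ordM ?ordV ?invr_eq0 // (ord1z' _ Qz).2; lia.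
Qed.

Lemma ordX P f n : f != 0 -> ord P (f ^+ n) = ord P f *+ n.
Proof.
by move=> f0; elim: n => [|n IH]; rewrite ?expr0 ?ord_1 // exprS ordM ?expf_neq0 // IH mulrS.
Qed.

(** By induction on [s]: to add a point [R], remove the pole of [z] at [R] and
    multiply a large power of the result by a function that separates [P] from
    [R]. *)
Lemma separation s P : exists z,
  [/\ z != 0, ord P z = 0 & forall Q, Q \in s -> Q <> P -> 0 < ord Q z].
Proof.
elim: s => [|R s [z [z0 Pz sz]]]; first by exists 1; split; rewrite ?oner_eq0 ?ord_1.
have [RP|RP] := pselect (R = P).
  exists z; split=> // Q; rewrite inE => /orP [/eqP -> //|]; exact: sz.
have [w w0 [Pw Rw]] := point_sep (nesym RP).
have [z' [z'0 Pz' Rz' z'z]] := remove_pole R z0 Pz.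
pose m := (\sum_(Q <- s) `|ord Q w|)%N.+1.
exists (z' ^+ m * w); split; first by rewrite mulf_neq0 ?expf_neq0.
  by rewrite ordM ?expf_neq0 // ordX // Pz' Pw mul0rn.
move=> Q; rewrite ordM ?expf_neq0 // ordX //.
rewrite inE => /orP [/eqP -> _|sQ QP]; first by rewrite -mulr_natr; nia.
have wm : (`|ord Q w| < m)%N by rewrite ltnS (big_rem Q) //= leq_addr.
have := z'z _ (sz _ sQ QP); rewrite -mulr_natr; nia.
Qed.

(** At the other points of [s], a large power of the separating function makes
    up for the orders of a function of order [n] at [P]. *)
Lemma approximation s P (n : int) (B : nat) : exists g,
  [/\ g != 0, ord P g = n & forall Q, Q \in s -> Q <> P -> B%:Z <= ord Q g].
Proof.
have [z [z0 Pz sz]] := separation s P.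
have [t t0 Pt] := ord_surj P.
have [u [u0 Pu]] : exists u, u != 0 /\ ord P u = n.
  case: n => n; first by exists (t ^+ n); rewrite expf_neq0 // ordX // Pt natz.
  exists (t ^+ n.+1)^-1; rewrite invr_eq0 expf_neq0 // ordV ?expf_neq0 //.
  by rewrite ordX // Pt natz NegzE.
pose m := (B + \sum_(Q <- s) `|ord Q u|)%N.
exists (z ^+ m * u); split; first by rewrite mulf_neq0 ?expf_neq0.
  by rewrite ordM ?expf_neq0 // ordX // Pz mul0rn add0r.
move=> Q sQ QP; rewrite ordM ?expf_neq0 // ordX //.
have um : (B + `|ord Q u| <= m)%N by rewrite leq_add2l (big_rem Q) //= leq_addr.
have := sz _ sQ QP; rewrite -mulr_natr; nia.
Qed.

(** Functions that are units at one zero of [h] and vanish at the others are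
    independent over [k(h)]. *)
Lemma zeros_bounded h : h != 0 -> exists N, forall s,
  uniq s -> (forall P, P \in s -> 0 < ord P h) -> (size s <= N)%N.
Proof.
move=> h0; have [N NP] := finite_over0 h0; exists N => s us hs.
rewrite leqNgt; apply/negP => ltNs.
pose p (i : 'I_(size s)) := tnth (in_tuple s) i.
have /choice [y yP] := fun i => approximation s (p i) 0 1.
have [|c [q [[i ci] cE]]] := NP 'I_(size s) y; first by rewrite card_ord.
have ps j : p j \in s by exact: mem_tnth.
have y_reg j l : ord_ge (p j) 0 (y l).
  have [yl0 pl ys] := yP l; right.
  have [->|ne] := pselect (p j = p l); first by rewrite pl.
  by have := ys _ (ps j) ne; lia.
have hi : ord_ge (p i) 1 h by right; have := hs _ (ps i); lia.
case/negP: ci; apply/eqP; have [yi0 pi ys] := yP i.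
apply: (@ord_ge_scale _ _ (p i) 1 _ (y i)); rewrite ?pi //.
have -> : c i *: y i = h * (\sum_l horner_alg h (q l) * y l)
    - \sum_(l | l != i) c l *: y l by rewrite -cE (bigD1 i) //= addrK.
apply: ord_geB.
  rewrite -[1]addr0; apply: ord_geM => //; apply: ord_ge_sum => l _.
  rewrite -[0]addr0; apply: ord_geM => //; apply: ord_ge_horner.
  by apply: ord_geW hi.
apply: ord_ge_sum => l ne; apply: ord_geZ; right.
have [_ _] := yP l; apply; first exact: ps.
have /tuple_uniqP p_inj : uniq (in_tuple s) := us.
by move=> /p_inj il; rewrite il eqxx in ne.
Qed.

Definition poles_within s g := forall P, ord_ge P (- (count_mem P s)%:Z) g.

Lemma poles_finite g : exists s, poles_within s g.
Proof.
have [->|g0] := eqVneq g 0; first by exists [::]; left.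
have [|N NP] := @zeros_bounded g^-1; first by rewrite invr_eq0.
pose S n := `[< exists s, [/\ uniq s, forall P, P \in s -> 0 < ord P g^-1 & size s = n] >].
have S0 : exists n, S n by exists 0%N; apply/asboolP; exists [::].
have SN n : S n -> (n <= N)%N by move=> /asboolP [s [us sP <-]]; exact: NP.
case: (ex_maxnP S0 SN) => n /asboolP [s [us sP sn]] nmax.
exists (flatten [seq nseq `|ord P g| P | P <- s]) => P; right.
have [Ps|Ps] := boolP (P \in s).
  rewrite count_flatten sumnE big_map big_map (big_rem P) //= count_nseq /= eqxx.
  by rewrite mul1n; lia.
suff : 0 <= ord P g by lia.
rewrite leNgt; apply/negP => Pg; suff /nmax : S n.+1 by rewrite ltnn.
apply/asboolP; exists (P :: s); split=> [|Q|]; rewrite /= ?Ps ?sn //.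
by rewrite inE => /orP [/eqP ->|/sP //]; rewrite ordV // oppr_gt0.
Qed.

(** Removing the points of [s] one at a time, each of them lowers the dimension
    by at most one, since the leading coefficients at a point lie in [k]; what
    is left at the end has no poles and a zero at [P0], so it vanishes. *)
Lemma dim_poles_within_zero s P0 (I : finType) (v : I -> C) :
  (forall i P, ord_ge P ((P == P0)%:Z - (count_mem P s)%:Z) (v i)) ->
  (size s < #|I|)%N ->
  exists2 c : I -> k, (exists i, c i != 0) & \sum_i c i *: v i = 0.
Proof.
elim: s I v => [|P s IH] I v vs lt_sI.
  exists (fun=> 1).
    have /card_gt0P [i _] := lt_sI; first by exists i; rewrite oner_eq0.
  apply: big1 => i _; rewrite (@global_vanishing (v i) P0) ?scaler0 //.
    by move=> Q; apply: ord_geW (vs i Q); rewrite /= subr0.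
  by have := vs i P0; rewrite eqxx.
pose n := (P == P0)%:Z - (count_mem P (P :: s))%:Z.
have [t [t0 Pt _]] := approximation [::] P n 0.
have /choice [c cP] : forall i, exists c : k, ord_ge P (n + 1) (v i - c *: t).
  move=> i; have [|c cP] := @residue _ _ P (v i / t).
    rewrite -[0](subrr n); apply: ord_geM; first exact: vs.
    by right; rewrite ordV // Pt.
  exists c; rewrite (_ : v i - c *: t = t * (v i / t - c%:A)).
    by apply: ord_geM => //; right; rewrite Pt.
  by rewrite mulrBr mulrCA divff // mulr1 -scalerAr mulr1.
have drop_P f : (forall Q, ord_ge Q ((Q == P0)%:Z - (count_mem Q (P :: s))%:Z) f) ->
    ord_ge P (n + 1) f -> forall Q, ord_ge Q ((Q == P0)%:Z - (count_mem Q s)%:Z) f.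
  move=> fs fP Q; have [->|QP] := eqVneq Q P.
    by apply: ord_geW fP; rewrite /n /= eqxx; lia.
  by have := fs Q; rewrite /= [P == Q]eq_sym (negbTE QP).
have [[i0 ci0]|nc] := pselect (exists i, c i != 0); last first.
  apply: IH; last exact: ltnW.
  move=> i; apply: drop_P => //; have := cP i.
  have -> : c i = 0 by apply: contra_notP nc => /eqP; exists i.
  by rewrite scale0r subr0.
pose w (i : {i in predC1 i0}) := v (val i) - (c (val i) / c i0) *: v i0.
have [||b [i bi] bE] := IH _ w.
- move=> i; apply: drop_P => [Q|]; first by apply: ord_geB => //; exact: ord_geZ.
  have -> : w i = (v (val i) - c (val i) *: t) - (c (val i) / c i0) *: (v i0 - c i0 *: t).
    by rewrite scalerBr scalerA divfK // opprB [RHS]addrA subrK.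
  by apply: ord_geB => //; exact: ord_geZ.
- by rewrite card_sig -ltnS (leq_trans lt_sI) // (cardC1 i0); case: #|I| lt_sI.
pose a j := if insub j is Some i then b i else
            - \sum_(i : {i in predC1 i0}) b i * (c (val i) / c i0).
exists a; first by exists (val i); rewrite /a valK.
rewrite (bigD1 i0) //= {1}/a insubN ?inE ?eqxx // scaleNr addrC.
apply/eqP; rewrite subr_eq0; apply/eqP; rewrite scaler_suml.
rewrite (big_sub (predC1 i0)) -[LHS]subr0 -[X in _ - X = _]bE -sumrB; apply: eq_bigr => j _.
by rewrite /a valK /w scalerBr scalerA opprB addrC subrK.
Qed.

(** The auxiliary point [P0] turns the multiset [s] into [P0 :: s] with a zero
    at [P0]. *)
Lemma dim_poles_within s (P0 : point C) (I : finType) (v : I -> C) :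
  (forall i, poles_within s (v i)) -> (size s < #|I|.-1)%N ->
  exists2 c : I -> k, (exists i, c i != 0) & \sum_i c i *: v i = 0.
Proof.
move=> vs lt_sI; apply: (@dim_poles_within_zero (P0 :: s) P0) => [i P|]; last first.
  by rewrite /= -ltn_predRL.
by apply: ord_geW (vs i P); rewrite /= [P0 == P]eq_sym; lia.
Qed.

Definition positive_part (D : divisor C) : seq (point C) :=
  flatten [seq nseq (absz (Num.max 0 (coeff P D))) P | P <- dom D].

Lemma count_positive_part D P :
  (count_mem P (positive_part D))%:Z = Num.max 0 (coeff P D).
Proof.
suff -> : count_mem P (positive_part D) = absz (Num.max 0 (coeff P D)) by lia.
rewrite count_flatten sumnE 2!big_map.
have [PD|PD] := boolP (P \in dom D); last first.
  rewrite coeff_outdom // big1_seq // => Q QD; rewrite count_nseq.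
  by rewrite (_ : pred1 P Q = false) //; apply/negbTE; apply: contraNneq PD => <-.
rewrite (bigD1_seq P) ?uniq_dom //= count_nseq /= eqxx mul1n big1 ?addn0 // => Q QP.
by rewrite count_nseq /= (negbTE QP).
Qed.

Lemma deg_positive_parts D :
  deg D = (size (positive_part D))%:Z - (size (positive_part (- D)))%:Z.
Proof.
have sizeE (E : divisor C) : (size (positive_part E))%:Z =
    \sum_(P <- dom E) Num.max 0 (coeff P E).
  rewrite size_flatten sumnE 2!big_map (big_morph Posz PoszD (erefl _)).
  by apply: eq_bigr => P _; rewrite size_nseq; lia.
rewrite !sizeE (perm_big _ (domN_perm_eq D)) -sumrB -[in LHS](freeg_sumE D) raddf_sum.
by apply: eq_bigr => P _ /=; rewrite degU coeffN; lia.
Qed.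

(** Functions [y t], one for each point of the multiset [s], whose orders at
    the points of [s] grow along [s]; they are independent over [k[f]] because
    [f] vanishes along all of [s]. *)
Lemma independent_over (s : seq (point C)) f : f != 0 ->
  (forall P, P \in s -> (count_mem P s)%:Z <= ord P f) ->
  exists y : 'I_(size s) -> C, forall p : 'I_(size s) -> {poly k},
    \sum_t horner_alg f (p t) * y t = 0 -> forall t, p t = 0.
Proof.
move=> f0 fs; pose q (t : 'I_(size s)) := tnth (in_tuple s) t.
have /choice [y yP] := fun t => approximation s (q t)
  (count_mem (q t) (take t s)) (size s).
have qs t : q t \in s by exact: mem_tnth.
have count_le P (t t' : nat) : (t <= t')%N ->
    (count_mem P (take t s) <= count_mem P (take t' s))%N.
  by move=> le_t; rewrite -(subnKC le_t) takeD count_cat leq_addr.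
have y_ge P (t : 'I_(size s)) : P \in s -> ord_ge P (count_mem P (take t s))%:Z (y t).
  move=> Ps; have [_ yt ys] := yP t; right.
  have [->|ne] := pselect (P = q t); first by rewrite yt.
  apply: le_trans (ys _ Ps ne); rewrite lez_nat (leq_trans (count_size _ _)) //.
  by rewrite size_take_min geq_minr.
exists y => p pE t; apply/eqP/negPn/negP => pt.
have [c [r [[i0 ci0] cE]]] := primitive_relation f0 (ex_intro (fun t => p t != 0) t pt) pE.
have [i ci imin] := @arg_minnP _ i0 (fun i => c i != 0) (fun i : 'I_(size s) => i : nat) ci0.
pose P := q i; have Ps : P \in s by exact: qs.
pose m := (count_mem P (take i s))%:Z.
have count_i : (count_mem P (take i.+1 s))%:Z = m + 1.
  have -> : take i.+1 s = rcons (take i s) P.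
    by rewrite (take_nth P) //; congr rcons; exact/esym/(tnth_nth P (in_tuple s)).
  by rewrite -cats1 count_cat /= eqxx addn0 PoszD.
case/negP: ci; apply/eqP; have [yi0 yi _] := yP i.
apply: (@ord_ge_scale _ _ P (m + 1) _ (y i)) => //; first by rewrite yi -/m; lia.
have -> : c i *: y i = f * (\sum_l horner_alg f (r l) * y l)
    - \sum_(l | l != i) c l *: y l by rewrite -cE (bigD1 i) //= addrK.
apply: ord_geB.
  rewrite -[m + 1]addr0; apply: ord_geM.
    right; apply: le_trans (fs _ Ps); rewrite -count_i lez_nat.
    by have := count_le P i.+1 (size s) (ltn_ord i); rewrite take_size.
  apply: ord_ge_sum => l _; rewrite -[0]addr0; apply: ord_geM.
    by apply: ord_ge_horner; right; have := fs _ Ps; lia.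
  by apply: ord_geW (y_ge P l Ps); lia.
apply: ord_ge_sum => l ne; have [->|cl] := eqVneq (c l) 0.
  by rewrite scale0r; left.
apply: ord_geZ; apply: ord_geW (y_ge P l Ps); rewrite -count_i.
have le_il : (i <= l)%N := imin _ cl.
by apply: count_le; rewrite ltn_neqAle le_il andbT eq_sym.
Qed.

Lemma poles_finite_family n (y : 'I_n -> C) : exists s, forall t, poles_within s (y t).
Proof.
have /choice [S SP] := fun t => poles_finite (y t).
exists (flatten [seq S t | t <- enum 'I_n]) => t P; apply: ord_geW (SP t P).
rewrite count_flatten sumnE 2!big_map (bigD1_seq t) ?mem_enum ?enum_uniq //=.
by rewrite lerN2 lez_nat leq_addr.
Qed.

(** Let [p] be the number of poles that [D] allows.  If [D] prescribed more than
    [p] zeros, there would be at least [(p + 1) * (N + 1)] independent functions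
    [f ^+ a * y t] with [a <= N], in a space of dimension [p * N] up to a
    constant. *)
Lemma deg_ge0 (D : divisor C) f : f != 0 -> h0 D f -> 0 <= deg D.
Proof.
move=> f0 fD; rewrite leNgt; apply/negP => degD.
pose sp := positive_part D; pose sn := positive_part (- D).
have lt_sp : (size sp < size sn)%N by move: degD; rewrite deg_positive_parts subr_lt0 ltz_nat.
have fD' P : - coeff P D <= ord P f by have := fD P; rewrite ord_geE.
have [y y_ind] : exists y : 'I_(size sn) -> C, forall p : 'I_(size sn) -> {poly k},
    \sum_t horner_alg f (p t) * y t = 0 -> forall t, p t = 0.
  apply: independent_over => // P; rewrite -has_pred1 has_count.
  by have := fD' P; have := count_positive_part (- D) P; rewrite -/sn coeffN; lia.
have [G yG] := poles_finite_family y.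
have [N NE] : exists N, N = (size G).+1 by eexists.
have [P0 _] : exists P, P \in sn.
  by case: sn lt_sp {y y_ind yG} => // P sn _; exists P; rewrite mem_head.
have [||c [[t0 a0] c0] cE] := @dim_poles_within (flatten (nseq N sp) ++ G) P0
  ('I_(size sn) * 'I_N.+1)%type (fun ta => f ^+ ta.2 * y ta.1).
- move=> [t a] P /=; rewrite count_cat PoszD opprD; apply: ord_geM; last exact: yG.
  have : ord_ge P (- (count_mem P sp)%:Z) f.
    by right; apply: le_trans (fD' P); rewrite count_positive_part; lia.
  move=> /(@ord_geX _ _ _ _ _ a); apply: ord_geW.
  rewrite count_flatten map_nseq sumn_nseq mulNrn lerN2 -mulr_natr natz.
  by rewrite -PoszM lez_nat leq_mul2l -ltnS ltn_ord orbT.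
- have -> : size (flatten (nseq N sp) ++ G) = (N * size sp + size G)%N.
    by rewrite size_cat; congr (_ + _)%N; elim: (N) => //= n IH; rewrite size_cat IH mulSn.
  by rewrite card_prod !card_ord NE; nia.
have : \sum_t horner_alg f (\poly_(a < N.+1) c (t, inord a)) * y t = 0.
  rewrite -[RHS]cE.
  transitivity (\sum_t \sum_(a < N.+1) c (t, a) *: (f ^+ a * y t)); last first.
    by rewrite pair_bigA; apply: eq_bigr => -[].
  apply: eq_bigr => t _; rewrite (horner_alg_coefs _ (size_poly _ _)) mulr_suml.
  by apply: eq_bigr => a _; rewrite coef_poly ltn_ord inord_val -scalerAl.
move=> /y_ind /(_ t0) /polyP /(_ a0); rewrite coef_poly ltn_ord inord_val coef0 => ct0.
by rewrite ct0 eqxx in c0.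
Qed.

End Degree.

(** * Gluing at the nodes *)

Section Agreement.
Variables (k : closedFieldType) (C C' : curve k).
Variables (P : point C) (Q : point C').
Implicit Types (D : divisor C) (E : divisor C') (e : C * C') (f : C) (g : C').

Lemma agree_congr D D' E E' e f g :
    coeff P D = coeff P D' -> coeff Q E = coeff Q E' ->
  agree P D Q E e f g -> agree P D' Q E' e f g.
Proof. by rewrite /agree => -> ->. Qed.

Lemma agree_linear D E e a f f' g g' :
    agree P D Q E e f g -> agree P D Q E e f' g' ->
  agree P D Q E e (a *: f + f') (a *: g + g').
Proof.
move=> [c [fc gc]] [c' [fc' gc']]; exists (a * c + c').
have comb (F : curve k) (x y e1 : F) :
    a *: x + y - (a * c + c') *: e1 = a *: (x - c *: e1) + (y - c' *: e1).
  by rewrite scalerDl -scalerA scalerBr opprD addrACA.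
by rewrite !comb; split; apply: ord_geD => //; apply: ord_geZ.
Qed.

Lemma agree_vanish D E e f g :
  ord_ge P (1 - coeff P D) f -> ord_ge Q (1 - coeff Q E) g -> agree P D Q E e f g.
Proof. by move=> fP gQ; exists 0; rewrite !scale0r !subr0. Qed.

Lemma agree_left0 D E e g :
  local_gen P D e.1 -> agree P D Q E e 0 g -> ord_ge Q (1 - coeff Q E) g.
Proof.
move=> [e0 Pe] [c [fc gc]]; suff c0 : c = 0 by rewrite c0 scale0r subr0 in gc.
apply: (@ord_ge_scale _ _ P (1 - coeff P D) c e.1 e0); first by rewrite Pe; lia.
by have := ord_geN fc; rewrite sub0r opprK.
Qed.

(** The fibres are one-dimensional over [k], so a multiple of any [g] not
    vanishing at [Q] has the value of [f] at [P]. *)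
Lemma agree_lift (W : set C') D E e f : subspace W ->
    local_gen P D e.1 -> local_gen Q E e.2 -> ord_ge P (- coeff P D) f ->
    (f != 0 -> ord P f = - coeff P D ->
      exists g, [/\ W g, g != 0 & ord Q g = - coeff Q E]) ->
  exists g, [/\ W g, ord_ge Q (- coeff Q E) g & agree P D Q E e f g].
Proof.
move=> sW [e0 Pe] [e0' Qe] fP ex_g.
have [fP1|nfP] := pselect (ord_ge P (1 - coeff P D) f).
  exists 0; split; [exact: sub0 | by left |].
  by apply: agree_vanish => //; left.
have f0 : f != 0 by apply/eqP => f0; apply: nfP; left.
have Pf : ord P f = - coeff P D by move: fP nfP; rewrite !ord_geE //; lia.
have [g [Wg g0 Qg]] := ex_g f0 Pf.
have fibre (F : curve k) (R : point F) (x y : F) : x != 0 -> y != 0 -> ord R x = ord R y ->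
    exists2 c : k, c != 0 & ord_ge R (ord R y + 1) (x - c *: y).
  move=> x0 y0 xy; have [|c cR] := @residue _ _ R (x / y).
    by rewrite ord_geE ?mulf_neq0 ?invr_eq0 // ordM ?invr_eq0 // ordV // xy subrr.
  have {cR} xcy : ord_ge R (ord R y + 1) (x - c *: y).
    rewrite (_ : x - c *: y = y * (x / y - c%:A)).
      by apply: ord_geM => //; right.
    by rewrite mulrBr mulrCA divff // mulr1 -scalerAr mulr1.
  exists c => //; apply/eqP => c0; move: xcy.
  by rewrite c0 scale0r subr0 ord_geE // xy; lia.
have [c c0 fc] := fibre _ P f e.1 f0 e0 (etrans Pf (esym Pe)).
have [c' c'0 gc'] := fibre _ Q g e.2 g0 e0' (etrans Qg (esym Qe)).
exists ((c / c') *: g); split; first exact: subZ.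
  by apply: ord_geZ; right; rewrite Qg.
exists c; split; first by rewrite Pe addrC in fc.
rewrite -[X in X *: e.2](divfK c'0) -(scalerA (c / c')) -scalerBr; apply: ord_geZ.
by rewrite Qe addrC in gc'.
Qed.

End Agreement.

Section AgreementSym.
Variables (k : closedFieldType) (C C' : curve k) (P : point C) (Q : point C').

Lemma agree_sym D E e f g :
  agree P D Q E e f g -> agree Q E P D (e.2, e.1) g f.
Proof. by move=> [c [fc gc]]; exists c. Qed.

End AgreementSym.

Lemma agree_right0 (k : closedFieldType) (C C' : curve k) (P : point C)
    (Q : point C') D E e f :
  local_gen Q E e.2 -> agree P D Q E e f 0 -> ord_ge P (1 - coeff P D) f.
Proof. by move=> Qe /agree_sym; exact: agree_left0. Qed.

Lemma h0_sub (k : closedFieldType) (C : curve k) (P : point C) (D : divisor C)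
    (m : nat) (f : C) :
  h0 (D - << m%:Z *g P >>) f <-> h0 D f /\ ord_ge P (m%:Z - coeff P D) f.
Proof.
split=> [fD|[fD fP] Q]; last first.
  rewrite coeffB coeffU; have [<-|] := eqVneq P Q; rewrite ?mulr1 ?mulr0.
    by rewrite opprB.
  by rewrite subr0 => _; exact: fD.
split=> [Q|]; last by have := fD P; rewrite coeffB coeffU eqxx mulr1 opprB.
by apply: ord_geW (fD Q); rewrite coeffB coeffU; case: eqP; rewrite ?mulr1 ?mulr0; lia.
Qed.

Lemma h0_linear (k : closedFieldType) (C : curve k) (D : divisor C) (a : k) (f g : C) :
  h0 D f -> h0 D g -> h0 D (a *: f + g).
Proof. by move=> fD gD P; apply: ord_geD => //; exact: ord_geZ. Qed.

Section Twists.
Variables (k : closedFieldType) (X : chain3 k) (d : nat) (L : inv_sheaf X).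
Variable (Ltw : nat -> nat -> inv_sheaf X).
Hypothesis LtwP : is_twist_family d L Ltw.

Local Notation A1 := (ptA1 X).
Local Notation A2 := (ptA2 X).
Local Notation B2 := (ptB2 X).
Local Notation B3 := (ptB3 X).
Local Notation D1 := (div1 (Ltw d 0%N)).
Local Notation D2 := (div2 (Ltw 0%N 0%N)).
Local Notation D3 := (div3 (Ltw 0%N d)).

(** The conditions that restrictions to [X_1], [X_2], [X_3] satisfy in
    [kernel], as subsheaves of the sheaves of the three linear series; [i] and
    [l] may exceed the range of the multidegrees. *)
Definition van1 (u : nat) (f : X1 X) : Prop := h0 (D1 - << u%:Z *g A1 >>) f.
Definition van2 (i l : nat) (f : X2 X) : Prop :=
  h0 (D2 - (<< i%:Z *g A2 >> + << l%:Z *g B2 >>)) f.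
Definition van3 (v : nat) (f : X3 X) : Prop := h0 (D3 - << v%:Z *g B3 >>) f.

Lemma div1E i l : (i + l <= d)%N -> div1 (Ltw i l) = D1 - << (d - i)%N%:Z *g A1 >>.
Proof.
move=> le_d; case: LtwP => tw _ _ _.
have [-> _ _] := tw i l le_d; have [|-> _ _] := tw d 0%N; first by rewrite addn0.
by rewrite subnn freegU0 subr0.
Qed.

Lemma div2E i l : (i + l <= d)%N ->
  div2 (Ltw i l) = D2 - (<< i%:Z *g A2 >> + << l%:Z *g B2 >>).
Proof.
move=> le_d; case: LtwP => tw _ _ _.
have [_ -> _] := tw i l le_d; have [|_ -> _] := tw 0%N 0%N => //.
rewrite freegU0 subr0 opprD !addrA -[X in _ = X - _]addrA freegUB.
by congr (_ + << _ *g _ >> - _); lia.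
Qed.

Lemma div3E i l : (i + l <= d)%N -> div3 (Ltw i l) = D3 - << (d - l)%N%:Z *g B3 >>.
Proof.
move=> le_d; case: LtwP => tw _ _ _.
have [_ _ ->] := tw i l le_d; have [|_ _ ->] := tw 0%N d => //.
by rewrite -addrA freegUB; congr (_ + << _ *g _ >>); lia.
Qed.

(** The gluing at [A] depends only on [i] and the gluing at [B] only on [l], so
    one sheaf for each value serves as a representative. *)
Definition agreeA (i : nat) := agree A1 (div1 (Ltw i 0)) A2 (div2 (Ltw i 0)) (glueA (Ltw i 0)).
Definition agreeB (l : nat) := agree B2 (div2 (Ltw 0 l)) B3 (div3 (Ltw 0 l)) (glueB (Ltw 0 l)).

Let A2B2 : (A2 == B2) = false.
Proof. by apply/eqP; exact: nodes_distinct. Qed.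

Lemma coeffA1 i l : (i + l <= d)%N ->
  coeff A1 (div1 (Ltw i l)) = coeff A1 D1 - (d - i)%N%:Z.
Proof. by move=> /div1E ->; rewrite coeffB coeffU eqxx mulr1. Qed.

Lemma coeffA2 i l : (i + l <= d)%N ->
  coeff A2 (div2 (Ltw i l)) = coeff A2 D2 - i%:Z.
Proof.
by move=> /div2E ->; rewrite coeffB coeffD !coeffU eqxx [B2 == _]eq_sym A2B2 mulr1 mulr0 addr0.
Qed.

Lemma coeffB2 i l : (i + l <= d)%N ->
  coeff B2 (div2 (Ltw i l)) = coeff B2 D2 - l%:Z.
Proof.
by move=> /div2E ->; rewrite coeffB coeffD !coeffU eqxx A2B2 mulr1 mulr0 add0r.
Qed.

Lemma coeffB3 i l : (i + l <= d)%N ->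
  coeff B3 (div3 (Ltw i l)) = coeff B3 D3 - (d - l)%N%:Z.
Proof. by move=> /div3E ->; rewrite coeffB coeffU eqxx mulr1. Qed.

Lemma H0E i l s : (i + l <= d)%N -> H0 (Ltw i l) s <->
  [/\ van1 (d - i) s.1.1, van2 i l s.1.2, van3 (d - l) s.2,
      agreeA i s.1.1 s.1.2 & agreeB l s.1.2 s.2].
Proof.
move=> le_d; have le_i : (i + 0 <= d)%N by lia.
have le_l : (0 + l <= d)%N by lia.
rewrite /H0 /= /van1 /van2 /van3 -(div1E le_d) -(div2E le_d) -(div3E le_d).
have gA : glueA (Ltw i l) = glueA (Ltw i 0) by case: LtwP => _ + _ _; apply.
have gB : glueB (Ltw i l) = glueB (Ltw 0 l) by case: LtwP => _ _ + _; apply.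
have A1E : coeff A1 (div1 (Ltw i l)) = coeff A1 (div1 (Ltw i 0)).
  by rewrite (coeffA1 le_d) (coeffA1 le_i).
have A2E : coeff A2 (div2 (Ltw i l)) = coeff A2 (div2 (Ltw i 0)).
  by rewrite (coeffA2 le_d) (coeffA2 le_i).
have B2E : coeff B2 (div2 (Ltw i l)) = coeff B2 (div2 (Ltw 0 l)).
  by rewrite (coeffB2 le_d) (coeffB2 le_l).
have B3E : coeff B3 (div3 (Ltw i l)) = coeff B3 (div3 (Ltw 0 l)).
  by rewrite (coeffB3 le_d) (coeffB3 le_l).
rewrite gA gB; split=> -[s1 s2 s3 sA sB]; split=> //.
- exact: (agree_congr A1E A2E sA).
- exact: (agree_congr B2E B3E sB).
- exact: (agree_congr (esym A1E) (esym A2E) sA).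
- exact: (agree_congr (esym B2E) (esym B3E) sB).
Qed.

Lemma van1E u f : van1 u f <-> h0 D1 f /\ ord_ge A1 (u%:Z - coeff A1 D1) f.
Proof. exact: h0_sub. Qed.

Lemma van2E i l f : van2 i l f <->
  [/\ h0 D2 f, ord_ge A2 (i%:Z - coeff A2 D2) f & ord_ge B2 (l%:Z - coeff B2 D2) f].
Proof.
rewrite /van2 opprD addrA; apply: (iff_trans (h0_sub _ _ _ _)).
rewrite coeffB coeffU A2B2 mulr0 subr0.
by split=> [[/h0_sub [? ?] ?]|[? ? ?]]; [split | split=> //; apply/h0_sub].
Qed.

Lemma van3E v f : van3 v f <-> h0 D3 f /\ ord_ge B3 (v%:Z - coeff B3 D3) f.
Proof. exact: h0_sub. Qed.

Lemma van1W u u' f : (u' <= u)%N -> van1 u f -> van1 u' f.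
Proof.
by move=> le_u /van1E [fD fP]; apply/van1E; split=> //; apply: ord_geW fP; lia.
Qed.

Lemma van2W i i' l l' f : (i' <= i)%N -> (l' <= l)%N -> van2 i l f -> van2 i' l' f.
Proof.
move=> le_i le_l /van2E [fD fA fB]; apply/van2E.
by split=> //; [apply: ord_geW fA | apply: ord_geW fB]; lia.
Qed.

Lemma van3W v v' f : (v' <= v)%N -> van3 v f -> van3 v' f.
Proof.
by move=> le_v /van3E [fD fP]; apply/van3E; split=> //; apply: ord_geW fP; lia.
Qed.

(** The sheaf has degree [d - i - l]. *)
Lemma van2_deg i l f : deg (div2 L) = 0 -> (d < i + l)%N -> van2 i l f -> f = 0.
Proof.
move=> degL2 lt_d fD; apply/eqP/negPn/negP => f0; have := deg_ge0 f0 fD.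
have [tw _ _ _] := LtwP; have [|_ -> _] := tw 0%N 0%N => //.
by rewrite !(degB, degD, degU) degL2; lia.
Qed.

Lemma agreeA_left i f g : (i <= d)%N -> van1 (d - i).+1 f -> van2 i.+1 0 g -> agreeA i f g.
Proof.
move=> le_i /van1E [_ fA] /van2E [_ gA _]; have le_i0 : (i + 0 <= d)%N by lia.
by apply: agree_vanish; rewrite ?(coeffA1 le_i0) ?(coeffA2 le_i0);
  [apply: ord_geW fA | apply: ord_geW gA]; lia.
Qed.

Lemma agreeB_left l f g : (l <= d)%N -> van2 0 l.+1 f -> van3 (d - l).+1 g -> agreeB l f g.
Proof.
move=> le_l /van2E [_ _ fA] /van3E [_ gA]; have le_0l : (0 + l <= d)%N by lia.
by apply: agree_vanish; rewrite ?(coeffB2 le_0l) ?(coeffB3 le_0l);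
  [apply: ord_geW fA | apply: ord_geW gA]; lia.
Qed.

Lemma van1_0 u : van1 u 0.
Proof. by move=> P; left. Qed.
Lemma van2_0 i l : van2 i l 0.
Proof. by move=> P; left. Qed.
Lemma van3_0 v : van3 v 0.
Proof. by move=> P; left. Qed.

Lemma agreeA_f0 i f : (i <= d)%N -> van1 (d - i) f -> agreeA i f 0 -> van1 (d - i).+1 f.
Proof.
move=> le_i /van1E [fD _] /(agree_right0 (glueA2P _)) fA; apply/van1E; split=> //.
have le_i0 : (i + 0 <= d)%N by lia.
by apply: ord_geW fA; rewrite (coeffA1 le_i0); lia.
Qed.

Lemma agreeA_0g i l g : (i <= d)%N -> van2 i l g -> agreeA i 0 g -> van2 i.+1 l g.
Proof.
move=> le_i /van2E [gD _ gB] /(agree_left0 (glueA1P _)) gA; apply/van2E; split=> //.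
have le_i0 : (i + 0 <= d)%N by lia.
by apply: ord_geW gA; rewrite (coeffA2 le_i0); lia.
Qed.

Lemma agreeB_f0 i l f : (l <= d)%N -> van2 i l f -> agreeB l f 0 -> van2 i l.+1 f.
Proof.
move=> le_l /van2E [fD fA _] /(agree_right0 (glueB3P _)) fB; apply/van2E; split=> //.
have le_0l : (0 + l <= d)%N by lia.
by apply: ord_geW fB; rewrite (coeffB2 le_0l); lia.
Qed.

Lemma agreeB_0g l g : (l <= d)%N -> van3 (d - l) g -> agreeB l 0 g -> van3 (d - l).+1 g.
Proof.
move=> le_l /van3E [gD _] /(agree_left0 (glueB2P _)) gB; apply/van3E; split=> //.
have le_0l : (0 + l <= d)%N by lia.
by apply: ord_geW gB; rewrite (coeffB3 le_0l); lia.
Qed.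

Lemma subspace_H0 i l : subspace (H0 (Ltw i l)).
Proof.
apply/subspaceP; split.
  by split=> [P|P|P||] /=; try (by left); apply: agree_vanish; left.
move=> a x y [x1 x2 x3 xA xB] [y1 y2 y3 yA yB].
by split=> /=; [exact: h0_linear | exact: h0_linear | exact: h0_linear
  | exact: agree_linear | exact: agree_linear].
Qed.

End Twists.

Section Orders.
Variables (k : closedFieldType) (C C' : curve k) (W : set C) (W' : set C').
Variables (D : divisor C) (D' : divisor C') (P : point C) (P' : point C').
Variables (r d : nat) (a b : 'I_r -> nat).
Hypothesis WD : W `<=` h0 D.
Hypothesis aE : vanishing_orders W D P = range a.
Hypothesis bE : vanishing_orders W' D' P' = range b.
Hypothesis abE : forall j, (a j + b (rev_ord j) = d)%N.

(** By refinedness, the order [n] on one side of the node occurs together with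
    the order [d - n] on the other. *)
Lemma dual_order f : W f -> f != 0 ->
  exists2 n : nat, (n <= d)%N /\ ord P f + coeff P D = n%:Z &
    exists g, [/\ W' g, g != 0 & ord P' g + coeff P' D' = (d - n)%N%:Z].
Proof.
move=> Wf f0; pose n := absz (ord P f + coeff P D).
have nE : ord P f + coeff P D = n%:Z.
  by have := WD Wf P; rewrite ord_geE // /n; lia.
have [j _ ajn] : range a n by rewrite -aE; exists f.
exists n; first by split=> //; rewrite -(abE j) ajn leq_addr.
have : range b (d - n)%N by exists (rev_ord j) => //; rewrite -(abE j) ajn addKn.
by rewrite -bE => -[g [Wg g0 gE]]; exists g.
Qed.

Lemma order_le f : W f -> f != 0 -> ord P f + coeff P D <= d%:Z.
Proof. by move=> Wf f0; have [n [le_n ->] _] := dual_order Wf f0. Qed.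

Lemma order_top f : W f -> ord_ge P (d.+1%:Z - coeff P D) f -> f = 0.
Proof.
move=> Wf fP; apply/eqP/negPn/negP => f0.
by have := order_le Wf f0; move: fP; rewrite ord_geE //; lia.
Qed.

(** Complementary orders of vanishing allow any value at the node to be
    extended to the other component. *)
Lemma refined_lift E E' e u f : (u <= d)%N -> subspace W' ->
    coeff P E = coeff P D - u%:Z -> coeff P' E' = coeff P' D' - (d - u)%N%:Z ->
    local_gen P E e.1 -> local_gen P' E' e.2 ->
    W f -> ord_ge P (u%:Z - coeff P D) f ->
  exists g, [/\ W' g, ord_ge P' ((d - u)%N%:Z - coeff P' D') g & agree P E P' E' e f g].
Proof.
move=> le_u sW' PE PE' e1 e2 Wf fP.
have [||g [Wg gP fg]] := agree_lift sW' e1 e2 (f := f).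
- by rewrite PE opprB.
- move=> f0; rewrite PE => fE; have [m [le_m mE] [g [Wg g0 gE]]] := dual_order Wf f0.
  exists g; split=> //; have mu : m = u by lia.
  by rewrite PE' -mu; lia.
by exists g; split=> //; rewrite PE' opprB in gP.
Qed.

End Orders.

(** * The kernels and the induction *)

Section Kernel.
Variables (k : closedFieldType) (X : chain3 k) (d : nat) (L : inv_sheaf X).
Variable (Ltw : nat -> nat -> inv_sheaf X).
Hypothesis LtwP : is_twist_family d L Ltw.
Hypothesis degL2 : deg (div2 L) = 0.
Variables V1 V2 V3 : set (sect X).
Hypothesis V1_sub : subspace V1 /\ V1 `<=` H0 (Ltw d 0%N).
Hypothesis V2_sub : subspace V2 /\ V2 `<=` H0 (Ltw 0%N 0%N).
Hypothesis V3_sub : subspace V3 /\ V3 `<=` H0 (Ltw 0%N d).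
Hypothesis V_linked : linked d V1 V2 V3.

Local Notation W1 := (series1 V1).
Local Notation W2 := (series2 V2).
Local Notation W3 := (series3 V3).
Local Notation van1 := (van1 d Ltw).
Local Notation van2 := (van2 Ltw).
Local Notation van3 := (van3 d Ltw).
Local Notation agreeA := (agreeA Ltw).
Local Notation agreeB := (agreeB Ltw).
Local Notation kernel := (kernel d Ltw V1 V2 V3).

Hypothesis top1 : forall f, W1 f -> van1 d.+1 f -> f = 0.
Hypothesis top3 : forall f, W3 f -> van3 d.+1 f -> f = 0.
Hypothesis lift21 : forall i l g, (i <= d)%N -> W2 g -> van2 i l g ->
  exists f, [/\ W1 f, van1 (d - i) f & agreeA i f g].
Hypothesis lift23 : forall i l g, (l <= d)%N -> W2 g -> van2 i l g ->
  exists f, [/\ W3 f, van3 (d - l) f & agreeB l g f].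
Hypothesis lift32 : forall l g, (l <= d)%N -> W3 g -> van3 (d - l) g ->
  exists f, [/\ W2 f, van2 0 l f & agreeB l f g].

Lemma subspace_series1 : subspace W1.
Proof.
case: V1_sub => sV _; apply/subspaceP; split; first by exists 0; [exact: sub0|].
by move=> a _ _ [s Vs <-] [t Vt <-]; exists (a *: s + t) => //; apply: subD => //; exact: subZ.
Qed.

Lemma subspace_series2 : subspace W2.
Proof.
case: V2_sub => sV _; apply/subspaceP; split; first by exists 0; [exact: sub0|].
by move=> a _ _ [s Vs <-] [t Vt <-]; exists (a *: s + t) => //; apply: subD => //; exact: subZ.
Qed.

Lemma subspace_series3 : subspace W3.
Proof.
case: V3_sub => sV _; apply/subspaceP; split; first by exists 0; [exact: sub0|].
by move=> a _ _ [s Vs <-] [t Vt <-]; exists (a *: s + t) => //; apply: subD => //; exact: subZ.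
Qed.

(** The vanishing conditions in [kernel] are already part of being a section of
    the twisted sheaf. *)
Lemma kernelE i l s : (i + l <= d)%N -> kernel i l s <->
  [/\ H0 (Ltw i l) s, W1 s.1.1, W2 s.1.2 & W3 s.2].
Proof.
move=> le_d; split=> [[sH [[? _] [? _] [? _]]]|[sH ? ? ?]]; split=> //.
by have /(H0E LtwP _ le_d) [? ? ? _ _] := sH; split; split.
Qed.

Lemma subspace_kernel i l : (i + l <= d)%N -> subspace (kernel i l).
Proof.
move=> le_d; have [sW1 sW2 sW3] := And3 subspace_series1 subspace_series2 subspace_series3.
have sH := subspace_H0 Ltw i l.
apply/subspaceP; split.
  by apply/kernelE => //; split; exact: sub0.
move=> a x y /(kernelE _ le_d) [xH x1 x2 x3] /(kernelE _ le_d) [yH y1 y2 y3].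
apply/kernelE => //; split=> /=; by apply: subD => //; exact: subZ.
Qed.

Lemma series_V1 s : V1 s -> [/\ W1 s.1.1, W2 s.1.2 & W3 s.2].
Proof.
move=> Vs; case: V_linked => V12 _ V23 _; split; first by exists s.
  exists (iter d (ext_compl Comp1) s); first by apply: V12; exists s.
  by elim: (d) => //= n ->.
exists (iter d (ext_comp Comp3) (iter d (ext_compl Comp1) s)).
  by apply: V23; eexists; last reflexivity; apply: V12; exists s.
by elim: (d) {2}(d) => [|n IH] m /=; [elim: m => //= n -> | rewrite IH].
Qed.

Lemma series_V2 s : V2 s -> [/\ W1 s.1.1, W2 s.1.2 & W3 s.2].
Proof.
move=> Vs; case: V_linked => _ V21 V23 _; split; last 2 first; first by exists s.
- exists (iter d (ext_comp Comp3) s); first by apply: V23; exists s.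
  by elim: (d) => //= n ->.
exists (iter d (ext_comp Comp1) s); first by apply: V21; exists s.
by elim: (d) => //= n ->.
Qed.

Lemma series_V3 s : V3 s -> [/\ W1 s.1.1, W2 s.1.2 & W3 s.2].
Proof.
move=> Vs; case: V_linked => _ V21 _ V32; split; last by exists s.
  exists (iter d (ext_comp Comp1) (iter d (ext_compl Comp3) s)).
    by apply: V21; eexists; last reflexivity; apply: V32; exists s.
  by elim: (d) {2}(d) => [|n IH] m /=; [elim: m => //= n -> | rewrite IH].
exists (iter d (ext_compl Comp3) s); first by apply: V32; exists s.
by elim: (d) => //= n ->.
Qed.

Local Notation W10 := (sub0 subspace_series1).
Local Notation W20 := (sub0 subspace_series2).
Local Notation W30 := (sub0 subspace_series3).

(** At the nodes, the section vanishes on [X_1] and [X_3] to one order more than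
    the new sheaf requires, so it agrees there with zero. *)
Lemma kernel_compl2 i l s : (i.+1 + l.+1 <= d)%N -> kernel i l s ->
  kernel i.+1 l.+1 (ext_compl Comp2 s).
Proof.
move=> le_d; have le_d' : (i + l <= d)%N by lia.
move=> /(kernelE _ le_d') [/(H0E LtwP _ le_d') [s1 s2 s3 sA sB] w1 w2 w3].
apply/kernelE => //=; split=> //; [|exact: W20].
apply/(H0E LtwP) => //=; split.
- by apply: van1W s1; lia.
- exact: van2_0.
- by apply: van3W s3; lia.
- by apply: (agreeA_left LtwP); [lia | apply: van1W s1; lia | exact: van2_0].
- by apply: (agreeB_left LtwP); [lia | exact: van2_0 | apply: van3W s3; lia].
Qed.

Lemma kernel_compl3 i l s : (i + l.+1 <= d)%N -> kernel i l.+1 s ->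
  kernel i l (ext_compl Comp3 s).
Proof.
move=> le_d; have le_d' : (i + l <= d)%N by lia.
move=> /(kernelE _ le_d) [/(H0E LtwP _ le_d) [s1 s2 s3 sA sB] w1 w2 w3].
apply/kernelE => //=; split=> //; [|exact: W30].
apply/(H0E LtwP) => //=; split=> //.
- exact: (van2W _ _ s2).
- exact: van3_0.
- apply: (agreeB_left LtwP); [lia | | exact: van3_0].
  exact: (van2W _ _ s2).
Qed.

Lemma kernel_comp3 l s : (l.+1 <= d)%N -> kernel 0 l s ->
  kernel 0 l.+1 (ext_comp Comp3 s).
Proof.
move=> le_d; have le_d' : (0 + l <= d)%N by lia.
move=> /(kernelE _ le_d') [/(H0E LtwP _ le_d') [s1 s2 s3 sA sB] w1 w2 w3].
apply/kernelE => //=; split=> //; [|exact: W10|exact: W20].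
apply/(H0E LtwP) => //=; split=> //.
- exact: van1_0.
- exact: van2_0.
- by apply: van3W s3; lia.
- by apply: (agreeA_left LtwP) => //; [exact: van1_0 | exact: van2_0].
- by apply: (agreeB_left LtwP) => //; [exact: van2_0 | apply: van3W s3; lia].
Qed.

(** The third component would vanish to order [d + 1] at [B]. *)
Lemma kernel_top3 i s : (i <= d)%N -> kernel i 0 s -> s.1.2 = 0 -> s.2 = 0.
Proof.
move=> le_i; have le_d : (i + 0 <= d)%N by lia.
move=> /(kernelE _ le_d) [/(H0E LtwP _ le_d) [_ _ s3 _ sB] _ _ w3] s20.
rewrite s20 in sB; have := agreeB_0g LtwP (leq0n d) s3 sB.
by rewrite subn0; exact: top3.
Qed.

(** The second component would vanish at both nodes as a section of a sheaf of
    degree one. *)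
Lemma kernel_top2 i l s : (i + l).+1 = d -> kernel i l s ->
  s.1.1 = 0 -> s.2 = 0 -> s.1.2 = 0.
Proof.
move=> dE; have le_d : (i + l <= d)%N by lia.
move=> /(kernelE _ le_d) [/(H0E LtwP _ le_d) [s1 s2 s3 sA sB] _ _ _] s10 s30.
apply: (van2_deg LtwP degL2 (i := i.+1) (l := l.+1)); first lia.
rewrite s10 in sA; rewrite s30 in sB.
apply: (agreeB_f0 LtwP) => //; first lia.
by apply: (agreeA_0g LtwP) => //; lia.
Qed.

(** Vanishing of the second component at [B] leaves room for a new third
    component with a complementary order of vanishing. *)
Lemma kernel_row0_compl3 l s : (l.+1 <= d)%N -> kernel 0 l s -> s.2 = 0 ->
  exists2 t, kernel 0 l.+1 t & ext_compl Comp3 t = s.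
Proof.
move=> le_d; have le_d' : (0 + l <= d)%N by lia.
move=> /(kernelE _ le_d') [/(H0E LtwP _ le_d') [s1 s2 _ sA sB] w1 w2 _] s30.
rewrite s30 in sB; have {}s2 := agreeB_f0 LtwP le_d' s2 sB.
have [f [Wf f3 fB]] := lift23 le_d w2 s2.
exists (s.1.1, s.1.2, f); last by rewrite /= -s30; case: s {w1 w2 s1 sA s30 sB s2 fB} => [[]].
by apply/kernelE => //; split=> //; apply/(H0E LtwP).
Qed.

(** A third component extends across [B] to [X_2] and then across [A] to [X_1].
    *)
Lemma kernel_row0_comp3 l t : (l.+1 <= d)%N -> kernel 0 l.+1 t ->
  t.1.1 = 0 -> t.1.2 = 0 -> exists2 s, kernel 0 l s & ext_comp Comp3 s = t.
Proof.
move=> le_d; have le_d' : (0 + l.+1 <= d)%N by [].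
move=> /(kernelE _ le_d') [/(H0E LtwP _ le_d') [_ _ t3 _ tB] _ _ w3] t10 t20.
rewrite t20 in tB; have {}t3 := agreeB_0g LtwP le_d t3 tB.
have le_l : (l <= d)%N := ltnW le_d.
rewrite subnSK // in t3.
have [g [Wg g2 gB]] := lift32 le_l w3 t3.
have [f [Wf f1 fA]] := lift21 (leq0n d) Wg g2.
exists (f, g, t.2); last by rewrite /= -t10 -t20; case: t {w3 t3 gB t10 t20 tB} => [[]].
by apply/kernelE => //; split=> //; apply/(H0E LtwP); rewrite ?subn0 // in f1 *.
Qed.

Lemma sect_eq0 (s : sect X) : s.1.1 = 0 -> s.1.2 = 0 -> s.2 = 0 -> s = 0.
Proof. by case: s => [[s1 s2] s3] /= -> -> ->. Qed.

Lemma kernel_vanish1 l s : (l <= d)%N -> kernel 0 l s -> s.1.2 = 0 -> s.1.1 = 0.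
Proof.
move=> le_d; have le_d' : (0 + l <= d)%N by [].
move=> /(kernelE _ le_d') [/(H0E LtwP _ le_d') [s1 _ _ sA _] w1 _ _] s20.
rewrite s20 in sA; have := agreeA_f0 LtwP (leq0n d) s1 sA.
by rewrite subn0; exact: top1.
Qed.

(** Linkage puts [V2] into the kernel; two sections of the kernel with the same
    second component are equal, because no order of vanishing exceeds [d]. *)
Lemma kernel00 : kernel 0 0 = V2.
Proof.
have le00 : (0 + 0 <= d)%N by [].
have [sV VH] := V2_sub; have VK : V2 `<=` kernel 0 0.
  move=> s Vs; apply/kernelE => //; have [? ? ?] := series_V2 Vs.
  by split=> //; exact: VH.
apply/seteqP; split=> // s Ks; have /(kernelE _ le00) [_ _ [t Vt t2] _] := Ks.
have Ku := subB (subspace_kernel le00) Ks (VK t Vt).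
have u2 : (s - t).1.2 = 0 by rewrite /= -t2 subrr.
suff : s - t = 0 by move/eqP; rewrite subr_eq0 => /eqP ->.
apply: sect_eq0 => //; first exact: kernel_vanish1 Ku u2.
exact: kernel_top3 Ku u2.
Qed.

Lemma kernel0d : kernel 0 d = V3.
Proof.
have le0d : (0 + d <= d)%N by [].
have [sV VH] := V3_sub; have VK : V3 `<=` kernel 0 d.
  move=> s Vs; apply/kernelE => //; have [? ? ?] := series_V3 Vs.
  by split=> //; exact: VH.
apply/seteqP; split=> // s Ks; have /(kernelE _ le0d) [_ _ _ [t Vt t3]] := Ks.
have Ku := subB (subspace_kernel le0d) Ks (VK t Vt).
have u3 : (s - t).2 = 0 by rewrite /= -t3 subrr.
suff : s - t = 0 by move/eqP; rewrite subr_eq0 => /eqP ->.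
have u2 : (s - t).1.2 = 0.
  have /(kernelE _ le0d) [/(H0E LtwP _ le0d) [_ v2 _ _ uB] _ _ _] := Ku.
  rewrite u3 in uB; apply: (van2_deg LtwP degL2 (i := 0%N) (l := d.+1)) => //.
  exact: (agreeB_f0 LtwP).
by apply: sect_eq0 => //; exact: kernel_vanish1 Ku u2.
Qed.

(** The section of [V1] with first component [s1] is [(s1, 0, 0)]: its other
    components would vanish to order [d + 1] at a node. *)
Lemma kernel_comp1_V1 i s : i.+1 = d -> kernel i 0 s -> V1 (ext_comp Comp1 s).
Proof.
move=> dE; have le_i : (i + 0 <= d)%N by lia.
have le_d0 : (d + 0 <= d)%N by lia.
move=> /(kernelE _ le_i) [/(H0E LtwP _ le_i) [s1 _ _ _ _] [t Vt ts] _ _].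
have [w1 w2 w3] := series_V1 Vt; have [_ VH] := V1_sub.
have /(H0E LtwP _ le_d0) [t1 t2 t3 tA tB] := VH _ Vt.
have s0 : agreeA d t.1.1 0.
  apply: (agreeA_left LtwP) => //; last exact: van2_0.
  by rewrite ts; apply: van1W s1; lia.
have t20 : t.1.2 = 0.
  apply: (van2_deg LtwP degL2 (i := d.+1) (l := 0%N)); first lia.
  apply: (agreeA_0g LtwP) => //.
  have := agree_linear (-1) s0 tA; rewrite scaleN1r addNr scaleN1r oppr0 add0r.
  by [].
have t30 : t.2 = 0.
  apply: top3 => //; rewrite t20 in tB.
  have := agreeB_0g LtwP (leq0n d) t3 tB; by rewrite subn0.
suff -> : ext_comp Comp1 s = t by [].
by rewrite /= -ts -t20 -t30; case: t {Vt ts w1 w2 w3 t1 t2 t3 tA tB s0 t20 t30} => [[]].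
Qed.

(** The second component has order [d] at [A], hence extends to a section [t]
    of [V1]; that [t] has the same second and third components follows from the
    bounds on the orders at the nodes. *)
Lemma kernel_lift_V1 i s : i.+1 = d -> kernel i 0 s -> s.1.1 = 0 ->
  exists2 t, V1 t & ext_compl Comp1 t = s.
Proof.
move=> dE; have le_i : (i + 0 <= d)%N by lia.
have le_d0 : (d + 0 <= d)%N by lia.
move=> /(kernelE _ le_i) [/(H0E LtwP _ le_i) [_ s2 s3 sA sB] _ w2 w3] s10.
rewrite s10 in sA; have {}s2 : van2 d 0 s.1.2.
  by rewrite -dE; apply: (agreeA_0g LtwP) => //; lia.
have [f [[t Vt tf] f1 fA]] := lift21 (leqnn d) w2 s2.
have [_ w2' w3'] := series_V1 Vt; have [_ VH] := V1_sub.
have /(H0E LtwP _ le_d0) [t1 t2 t3 tA tB] := VH _ Vt.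
have ts2 : t.1.2 = s.1.2.
  apply/eqP; rewrite -subr_eq0; apply/eqP.
  apply: (van2_deg LtwP degL2 (i := d.+1) (l := 0%N)); first lia.
  apply: (agreeA_0g LtwP) => //.
    by rewrite addrC -scaleN1r; exact: h0_linear.
  by have := agree_linear (-1) fA tA; rewrite -tf scaleN1r addNr scaleN1r addrC.
exists t => //.
have ts3 : t.2 = s.2.
  apply/eqP; rewrite -subr_eq0; apply/eqP; apply: top3.
    exact: subB subspace_series3 _ _ w3' w3.
  have u3 : van3 (d - 0) (t.2 - s.2) by rewrite addrC -scaleN1r; exact: h0_linear.
  have := agreeB_0g LtwP (leq0n d) u3; rewrite subn0; apply.
  by have := agree_linear (-1) sB tB; rewrite ts2 scaleN1r addNr scaleN1r addrC.
by rewrite /= ts2 ts3 -s10; case: s {s10 s2 s3 sA sB w2 w3 fA ts2 ts3} => [[]].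
Qed.

Lemma kernel_row0_exact l : (l < d)%N -> exact_at Comp3 (kernel 0 l.+1) (kernel 0 l).
Proof.
move=> lt_l; split; apply/seteqP; split.
- move=> _ [s Ks <-]; split=> //; exact: (kernel_compl3 (i := 0%N)).
- move=> s [Ks /= [s3]]; have [t Kt <-] := kernel_row0_compl3 lt_l Ks s3; by exists t.
- move=> _ [s Ks <-]; split=> //; exact: kernel_comp3.
- move=> s [Ks /= [s1 s2]]; have [t Kt <-] := kernel_row0_comp3 lt_l Ks s1 s2; by exists t.
Qed.

Variable n : nat.
Hypothesis V1_dim : has_dim V1 n.
Hypothesis V2_dim : has_dim V2 n.

Lemma kernel_row0_dim l : (l <= d)%N -> has_dim (kernel 0 l) n.
Proof.
elim: l => [_|l IH lt_l]; first by rewrite kernel00.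
apply: exact_pair_dim (IH (ltnW lt_l)); first exact: subspace_kernel.
exact/exact_pair_sym/kernel_row0_exact.
Qed.

Variable V : nat -> nat -> set (sect X).
Hypothesis V_coll : is_collection d Ltw V.

Let sV i l : (i + l <= d)%N -> subspace (V i l).
Proof. by move=> /V_coll []. Qed.

Let bottom_left i l : (i.+1 + l <= d)%N -> V i l `<=` kernel i l ->
  l = 0%N -> forall s, V i l s -> s.1.1 = 0 -> s.1.2 = 0 -> s.2 = 0.
Proof.
move=> le_d VK l0 s /VK; rewrite l0 => Ks _ s2.
by apply: (kernel_top3 (i := i) _ Ks s2); lia.
Qed.

Let bottom_right i l : V i l `<=` kernel i l -> (i.+1 + l)%N = d ->
  forall s, V i l s -> s.1.1 = 0 -> s.2 = 0 -> s.1.2 = 0.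
Proof. by move=> VK dE s /VK Ks; exact: (kernel_top2 (i := i) (l := l)). Qed.

Lemma exact_last_row i : i.+1 = d -> V i 0%N `<=` kernel i 0 -> has_dim (V i 0%N) n ->
  exact_at Comp1 V1 (V i 0%N).
Proof.
move=> dE VK Vn; apply/exact_atE; apply: (exact_pair_of_dim V1_dim Vn).
  move=> s [Vs /= [s1]]; have [t V1t <-] := kernel_lift_V1 dE (VK s Vs) s1; by exists t.
move=> _ [s Vs <-]; split=> //; exact: (kernel_comp1_V1 dE (VK s Vs)).
Qed.

Section Constructed.
Hypothesis Vc : is_constructed d Ltw V1 V2 V3 V.

(** The induction runs over the rows by increasing [i], and within the row
    [i+1] by decreasing [l]; [good_cell i l] collects what is known about the
    space at [(i+1,l)]. *)
Definition good_row i := forall l, (i + l <= d)%N ->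
  [/\ V i l `<=` kernel i l, has_dim (V i l) n &
      (i + l < d)%N -> exact_at Comp3 (V i l.+1) (V i l)].

Definition good_cell i l :=
  [/\ V i.+1 l `<=` kernel i.+1 l, has_dim (V i.+1 l) n,
      (i.+1 + l < d)%N -> exact_at Comp3 (V i.+1 l.+1) (V i.+1 l),
      exact_at Comp1 (V i.+1 l) (V i l) &
      (0 < l)%N -> exact_at Comp2 (V i l.-1) (V i.+1 l)].

Lemma good_row0 : good_row 0.
Proof.
case: Vc => V0 _ _ l le_l; rewrite (V0 _ le_l).
split=> // [|lt_l]; first exact: kernel_row0_dim.
by rewrite (V0 _ lt_l); exact: kernel_row0_exact.
Qed.

Lemma good_cell_step i l : (i.+1 < d)%N -> (i.+1 + l <= d)%N -> good_row i ->
  ((i.+1 + l < d)%N -> good_cell i l.+1) -> good_cell i l.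
Proof.
move=> lt_i le_d Ri right_cell.
have le_d' : (i + l <= d)%N by lia.
have [VK Vn _] := Ri l le_d'.
have bl := bottom_left le_d VK; have br := @bottom_right i l VK.
have el : (0 < l)%N -> exact_at Comp3 (V i l) (V i l.-1).
  by case: (l) le_d' => // l' le_l' _; have [|_ _] := Ri l'; [lia | apply; lia].
have er : (i.+1 + l < d)%N -> exact_at Comp2 (V i l) (V i.+1 l.+1).
  by move=> /right_cell [_ _ _ _]; apply.
have [_ _ /(_ i.+1 l)] := Vc; rewrite /construction_step /= lt_i leq_subRL ?(ltnW lt_i) //.
case=> // m [p [beta [_ _ _ [u [v [[u_ind _] u_dir vK uv UE]]]]]].
have built := @built_exact1 _ _ _ _ _ _ sV lt_i le_d bl br el er _ u v u_ind u_dir uv UE.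
have builtn := built_dim sV lt_i le_d bl br el er u_ind u_dir uv UE Vn.
split=> //.
- have K0 : kernel i.+1 l 0 by exact: (sub0 (subspace_kernel le_d)).
  have sK := subspace_kernel le_d.
  rewrite UE => _ [_ [a Sa [b Sb <-]] [_ [c _ <-] <-]].
  apply: (subD sK); last by apply: sub_comb.
  apply: (subD sK).
    move: Sa; case: ifP => [l0 [s Vs <-]|_ -> //].
    case: (l) l0 le_d Vs => // l' _ le_l' Vs; apply: kernel_compl2 => //.
    by have [|VK' _ _] := Ri l'; [lia | exact: VK'].
  move: Sb; case: ifP => [lt_l [s Vs <-]|_ -> //].
  by have [VK' _ _ _ _] := right_cell lt_l; apply: kernel_compl3; [lia | exact: VK'].
- move=> lt_l; have [_ Vn' _ _ _] := right_cell lt_l.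
  exact: (built_exact3 sV lt_i le_d bl br el er u_ind u_dir uv UE Vn lt_l Vn').
- move=> l0; have [|_ Vn' _] := Ri l.-1; first by lia.
  exact: (built_exact2 sV lt_i le_d bl br el er u_ind u_dir uv UE Vn l0 Vn').
Qed.

Lemma good_cells i l : (i.+1 < d)%N -> (i.+1 + l <= d)%N -> good_row i -> good_cell i l.
Proof.
move=> lt_i; have [m] := ubnP (d - l)%N; elim: m l => // m IH l lt_m le_d Ri.
by apply: good_cell_step => // lt_l; apply: IH => //; lia.
Qed.

Lemma good_rows i : (i < d)%N -> good_row i.
Proof.
elim: i => [_|i IH lt_i]; first exact: good_row0.
move=> l le_d; have [? ? ? _ _] := good_cells lt_i le_d (IH (ltnW lt_i)).
by split.
Qed.

Lemma constructed_exact q i l i' l' : is_tilde d q i l i' l' ->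
  exact_at q (V i l) (V i' l').
Proof.
case: q => -[le_d le_d'] [Ei El]; subst.
- have [lt_i|] := boolP (i'.+1 < d)%N.
    by have [] := good_cells lt_i le_d (good_rows (ltnW lt_i)).
  rewrite -leqNgt => le_i; have dE : i'.+1 = d by lia.
  have l0 : l = 0%N by lia.
  subst l; have [_ Vd _] := Vc; rewrite [in V _.+1 _]dE Vd.
  have lt_i : (i' < d)%N by lia.
  have [|VK Vn _] := good_rows lt_i (l := 0%N); first by lia.
  exact: exact_last_row.
- have lt_i : (i.+1 < d)%N by lia.
  have lt_i' : (i < d)%N by lia.
  by have [_ _ _ _] := good_cells lt_i le_d' (good_rows lt_i'); apply.
- have lt_i : (i < d)%N by lia.
  by have [_ _] := good_rows lt_i le_d'; apply; lia.
Qed.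

Lemma constructed_dim i l : (i + l <= d)%N -> has_dim (V i l) n.
Proof.
move=> le_d; have [lt_i|] := boolP (i < d)%N.
  by have [] := good_rows lt_i le_d.
rewrite -leqNgt => le_i; have -> : i = d by lia.
have -> : l = 0%N by lia.
by have [_ -> _] := Vc.
Qed.

End Constructed.

Section Exact.
Hypothesis V_dim : forall i l, (i + l <= d)%N -> has_dim (V i l) n.
Hypothesis V_exact : is_exact d V.
Hypothesis V_ends : [/\ V d 0%N = V1, V 0%N 0%N = V2 & V 0%N d = V3].

(** Following the maps to the three corners of the triangle of multidegrees
    preserves one component each, which therefore belongs to [V1], [V2] or
    [V3]. *)
Lemma exact_sub_kernel i l : (i + l <= d)%N -> V i l `<=` kernel i l.
Proof.
move=> le_d s Vs; have [Vd V0 V0d] := V_ends; apply/kernelE => //.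
have left1 i' l' t : (i'.+1 + l' <= d)%N -> V i'.+1 l' t -> V i' l' (ext_compl Comp1 t).
  move=> le Vt; have [|+ _] := @V_exact Comp1 i'.+1 l' i' l'; first by split=> //; lia.
  move=> E; have : van_comp Comp1 (V i' l') (ext_compl Comp1 t); last by case.
  by rewrite -E; exists t.
have right1 i' l' t : (i'.+1 + l' <= d)%N -> V i' l' t -> V i'.+1 l' (ext_comp Comp1 t).
  move=> le Vt; have [|_ E] := @V_exact Comp1 i'.+1 l' i' l'; first by split=> //; lia.
  by have : van_compl Comp1 (V i'.+1 l') (ext_comp Comp1 t); [rewrite -E; exists t | case].
have down3 i' l' t : (i' + l'.+1 <= d)%N -> V i' l'.+1 t -> V i' l' (ext_compl Comp3 t).
  move=> le Vt; have [|E _] := @V_exact Comp3 i' l'.+1 i' l'; first by split=> //; lia.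
  by have : van_comp Comp3 (V i' l') (ext_compl Comp3 t); [rewrite -E; exists t | case].
have up3 i' l' t : (i' + l'.+1 <= d)%N -> V i' l' t -> V i' l'.+1 (ext_comp Comp3 t).
  move=> le Vt; have [|_ E] := @V_exact Comp3 i' l'.+1 i' l'; first by split=> //; lia.
  by have : van_compl Comp3 (V i' l'.+1) (ext_comp Comp3 t); [rewrite -E; exists t | case].
have to_l0 l' i' t : (i' + l' <= d)%N -> V i' l' t ->
    exists t', [/\ V i' 0%N t', t'.1.1 = t.1.1 & t'.1.2 = t.1.2].
  elim: l' t => [|l' IH] t le Vt; first by exists t.
  have [|t' [Vt' t1 t2]] := IH _ _ (down3 _ _ _ le Vt); first by lia.
  by exists t'.
have to_i0 i' l' t : (i' + l' <= d)%N -> V i' l' t ->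
    exists t', [/\ V 0%N l' t', t'.1.2 = t.1.2 & t'.2 = t.2].
  elim: i' t => [|i' IH] t le Vt; first by exists t.
  have [|t' [Vt' t1 t2]] := IH _ _ (left1 _ _ _ le Vt); first by lia.
  by exists t'.
have to_id m i' t : (i' + m)%N = d -> V i' 0%N t -> exists2 t', V d 0%N t' & t'.1.1 = t.1.1.
  elim: m i' t => [|m IH] i' t dE Vt; first by exists t; rewrite // -dE addn0.
  have [||t' Vt' t1] := IH i'.+1 (ext_comp Comp1 t); [by lia | | by exists t'].
  by apply: right1 => //; lia.
have to_ld m l' t : (l' + m)%N = d -> V 0%N l' t -> exists2 t', V 0%N d t' & t'.2 = t.2.
  elim: m l' t => [|m IH] l' t dE Vt; first by exists t; rewrite // -dE addn0.
  have [||t' Vt' t1] := IH l'.+1 (ext_comp Comp3 t); [by lia | | by exists t'].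
  by apply: up3 => //; lia.
split; first by case: (V_coll le_d) => _; exact.
- have [t [Vt t1 _]] := to_l0 _ _ _ le_d Vs.
  have [|t' Vt' t1'] := to_id (d - i)%N i t _ Vt; first by lia.
  by exists t'; rewrite -?Vd // t1'.
- have [t [Vt _ t2]] := to_l0 _ _ _ le_d Vs.
  have [|t' [Vt' t2' _]] := to_i0 _ _ _ _ Vt; first by lia.
  by exists t'; rewrite -?V0 // t2'.
- have [t [Vt _ t3]] := to_i0 _ _ _ le_d Vs.
  have [|t' Vt' t3'] := to_ld (d - l)%N l t _ Vt; first by lia.
  by exists t'; rewrite -?V0d // t3'.
Qed.

Lemma exact_constructed : is_constructed d Ltw V1 V2 V3 V.
Proof.
have [Vd _ _] := V_ends; split=> // [l le_l|[//|i] l lt_i le_l].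
  apply: has_dim_sub_eq (V_dim _) (kernel_row0_dim le_l) (exact_sub_kernel _) => //.
have le_d : (i.+1 + l <= d)%N by lia.
have le_d' : (i + l <= d)%N by lia.
have VK := exact_sub_kernel le_d'.
have el : (0 < l)%N -> exact_at Comp3 (V i l) (V i l.-1).
  by case: (l) le_d' => // l' le_l' _; apply: V_exact; split=> //; lia.
have er : (i.+1 + l < d)%N -> exact_at Comp2 (V i l) (V i.+1 l.+1).
  by move=> lt_l; apply: V_exact; split=> //; lia.
have E1 : exact_at Comp1 (V i.+1 l) (V i l) by apply: V_exact.
have SU2 : from_left V i l `<=` V i.+1 l.
  rewrite /from_left; case: ifP => [l0|_ _ ->]; last exact: (sub0 (sV le_d)).
  have [|-> _ s []//] := @V_exact Comp2 i l.-1 i.+1 l.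
  by split; [lia | lia | lia].
have SU3 : from_right d V i l `<=` V i.+1 l.
  rewrite /from_right; case: ifP => [lt_l|_ _ ->]; last exact: (sub0 (sV le_d)).
  by have [|-> _ s []//] := @V_exact Comp3 i.+1 l.+1 i.+1 l; split; lia.
have [m [p [beta [Vm Wp mE [u [v [uV udir vU uv UE]]]]]]] :=
  exact_is_built sV lt_i le_d (bottom_left le_d VK) (@bottom_right i l VK) el er
    (V_dim le_d') E1 SU2 SU3.
exists m, p, beta; split=> //; exists u, v; split=> // j.
exact: (exact_sub_kernel le_d (vU j)).
Qed.

End Exact.

End Kernel.

(** * The theorem *)

Theorem mainTheorem3 (k : closedFieldType) (X : chain3 k) (d r : nat)
    (L : inv_sheaf X) (Ltw : nat -> nat -> inv_sheaf X)
    (degL1 : deg (div1 L) = d%:Z)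
    (degL2 : deg (div2 L) = 0)
    (degL3 : deg (div3 L) = 0)
    (LtwP : is_twist_family d L Ltw)
    (V1 V2 V3 : set (sect X))
    (V1_sub : subspace V1 /\ V1 `<=` H0 (Ltw d 0%N))
    (V2_sub : subspace V2 /\ V2 `<=` H0 (Ltw 0%N 0%N))
    (V3_sub : subspace V3 /\ V3 `<=` H0 (Ltw 0%N d))
    (V1_dim : has_dim V1 r.+1)
    (V2_dim : has_dim V2 r.+1)
    (V3_dim : has_dim V3 r.+1)
    (V_linked : linked d V1 V2 V3)
    (a b b' c : 'I_r.+1 -> nat)
    (a_incr : {homo a : j j' / (j < j')%N})
    (b_incr : {homo b : j j' / (j < j')%N})
    (b'_incr : {homo b' : j j' / (j < j')%N})
    (c_incr : {homo c : j j' / (j < j')%N})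
    (a_ord : vanishing_orders (series1 V1) (div1 (Ltw d 0%N)) (ptA1 X)
               = range a)
    (b_ord : vanishing_orders (series2 V2) (div2 (Ltw 0%N 0%N)) (ptA2 X)
               = range b)
    (b'_ord : vanishing_orders (series2 V2) (div2 (Ltw 0%N 0%N)) (ptB2 X)
                = range b')
    (c_ord : vanishing_orders (series3 V3) (div3 (Ltw 0%N d)) (ptB3 X)
               = range c)
    (refinedA : forall j : 'I_r.+1, (a (rev_ord j) + b j = d)%N)
    (refinedB : forall j : 'I_r.+1, (b' j + c (rev_ord j) = d)%N)
    (V : nat -> nat -> set (sect X))
    (V_coll : is_collection d Ltw V) :
  is_exact_extension d r Ltw V1 V2 V3 V <-> is_constructed d Ltw V1 V2 V3 V.
Proof.
have rA j : (b j + a (rev_ord j) = d)%N by rewrite addnC.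
have rA' j : (a j + b (rev_ord j) = d)%N by rewrite -{1}[j]rev_ordK.
have rB j : (c j + b' (rev_ord j) = d)%N by rewrite addnC -{2}[j]rev_ordK.
have [sV1 V1H] := V1_sub; have [sV2 V2H] := V2_sub; have [sV3 V3H] := V3_sub.
have W1D : series1 V1 `<=` h0 (div1 (Ltw d 0)) by move=> _ [s /V1H [] ? _ _ _ _ <-].
have W2D : series2 V2 `<=` h0 (div2 (Ltw 0 0)) by move=> _ [s /V2H [] _ ? _ _ _ <-].
have W3D : series3 V3 `<=` h0 (div3 (Ltw 0 d)) by move=> _ [s /V3H [] _ _ ? _ _ <-].
have sW1 := subspace_series1 V1_sub.
have sW2 := subspace_series2 V2_sub.
have sW3 := subspace_series3 V3_sub.
have top1 f : series1 V1 f -> van1 d Ltw d.+1 f -> f = 0.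
  by move=> Wf /van1E [_]; exact: (order_top W1D a_ord b_ord rA' Wf).
have top3 f : series3 V3 f -> van3 d Ltw d.+1 f -> f = 0.
  by move=> Wf /van3E [_]; exact: (order_top W3D c_ord b'_ord rB Wf).
have lift21 i l g : (i <= d)%N -> series2 V2 g -> van2 Ltw i l g ->
    exists f, [/\ series1 V1 f, van1 d Ltw (d - i) f & agreeA Ltw i f g].
  move=> le_i Wg /van2E [_ gA _]; have le_i0 : (i + 0 <= d)%N by lia.
  have [f [Wf fA fg]] := refined_lift (e := ((glueA (Ltw i 0)).2, (glueA (Ltw i 0)).1))
    W2D b_ord a_ord rA le_i sW1 (coeffA2 LtwP le_i0) (coeffA1 LtwP le_i0)
    (glueA2P _) (glueA1P _) Wg gA.
  exists f; split=> //; first by apply/van1E; split=> //; exact: W1D.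
  by have := agree_sym fg; rewrite /agreeA; case: (glueA _).
have lift23 i l g : (l <= d)%N -> series2 V2 g -> van2 Ltw i l g ->
    exists f, [/\ series3 V3 f, van3 d Ltw (d - l) f & agreeB Ltw l g f].
  move=> le_l Wg /van2E [_ _ gB]; have le_0l : (0 + l <= d)%N by lia.
  have [f [Wf fB gf]] := refined_lift W2D b'_ord c_ord refinedB le_l sW3
    (coeffB2 LtwP le_0l) (coeffB3 LtwP le_0l) (glueB2P _) (glueB3P _) Wg gB.
  by exists f; split=> //; apply/van3E; split=> //; exact: W3D.
have lift32 l g : (l <= d)%N -> series3 V3 g -> van3 d Ltw (d - l) g ->
    exists f, [/\ series2 V2 f, van2 Ltw 0 l f & agreeB Ltw l f g].
  move=> le_l Wg /van3E [_ gB]; have le_0l : (0 + l <= d)%N by lia.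
  have B2E : coeff (ptB2 X) (div2 (Ltw 0 l)) =
      coeff (ptB2 X) (div2 (Ltw 0 0)) - (d - (d - l))%N%:Z.
    by rewrite (coeffB2 LtwP le_0l) subKn.
  have [f [Wf fB gf]] := refined_lift (e := ((glueB (Ltw 0 l)).2, (glueB (Ltw 0 l)).1))
    W3D c_ord b'_ord rB (leq_subr l d) sW2
    (coeffB3 LtwP le_0l) B2E (glueB3P _) (glueB2P _) Wg gB.
  rewrite subKn // in fB; have fD := W2D _ Wf.
  exists f; split=> //; last by have := agree_sym gf; rewrite /agreeB; case: (glueB _).
  apply/van2E; split=> //.
  by apply: ord_geW (fD (ptA2 X)); rewrite add0r.
split=> [[[_ V_dim _] V_exact V_ends]|Vc].
  exact: (exact_constructed LtwP degL2 V1_sub V2_sub V3_sub V_linked top1 top3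
    lift21 lift23 lift32 V2_dim V_coll V_dim V_exact V_ends).
have ex := constructed_exact LtwP degL2 V1_sub V2_sub V3_sub V_linked top1 top3
    lift21 lift23 lift32 V1_dim V2_dim V_coll Vc.
have dims := constructed_dim LtwP degL2 V1_sub V2_sub V3_sub V_linked top1 top3
    lift21 lift23 lift32 V1_dim V2_dim V_coll Vc.
have [V0 Vd _] := Vc.
split=> [|q i l i' l' /ex [] //|]; last first.
  split=> //; first by rewrite V0 // (kernel00 LtwP degL2 V1_sub V2_sub V3_sub).
  by rewrite V0 // (kernel0d LtwP degL2 V1_sub V2_sub V3_sub).
split=> // q i l i' l' /ex [E E']; split.
  by rewrite E => s [].
by rewrite E' => s [].
Qed.
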